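(* Let $L$ be a linear, closed, densely defined (not necessarily selfadjoint) operator in a Hilbert space $H$, let $f\in H$ be generic (in the sense defined in the context), and let $w(t)$ be the solution of $$\ddot w+Lw=0,\quad t>0,\qquad w(0)=0,\quad \dot w(0)=f .$$ Suppose that Assumptions A and B (stated in the context) hold, and suppose that for every (arbitrarily small) $\epsilon>0$ $$\left\|\int_0^t w(s)\,ds\right\|=O(e^{\epsilon t}),\qquad t\to\infty .$$ Then for every $k\in\mathbb{R}$ with $k\ne k_j$, $1\le j\le J$ (where the $k_j$ are the real numbers appearing in Assumption A), the limiting amplitude principle holds: if $u(t)$ is the solution of $$\ddot u+Lu=fe^{-ikt},\quad t>0,\qquad u(0)=0,\quad \dot u(0)=0,$$ then the limit $$v=\lim_{t\to\infty}\frac1t\int_0^t u(s)e^{iks}\,ds$$ exists in $H$ and solves the equation $Lv-k^2v=f$.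
   Context: $\|\cdot\|$ is the norm of $H$, $I$ is the identity operator, and dots denote derivatives in $t$. It is assumed that $\|u(t)\|\le ce^{at}$ and $\|w(t)\|\le c e^{at}$ for some constants $c>0$, $a\ge 0$. The Laplace transforms are $\mathcal{U}(p)=\int_0^\infty e^{-pt}u(t)\,dt$ and $\mathcal{W}(p)=\int_0^\infty e^{-pt}w(t)\,dt$ for $\operatorname{Re}p=\sigma>a$, where $p=\sigma+i\tau$. They satisfy $L\mathcal U+p^2\mathcal U=\frac{f}{p+ik}$ and $L\mathcal W+p^2\mathcal W=f$, so $\mathcal{W}(p)=(L+p^2I)^{-1}f$. Generic $f$: if a point $p$ is a pole of the kernel of the operator $(L+p^2I)^{-1}$, then it is a pole of the same order of the element $(L+p^2I)^{-1}f=\mathcal W(p)$. Assumption A: for generic $f$, $\mathcal{W}(p)=(L+p^2I)^{-1}f$ is analytic in the half-plane $\sigma=\operatorname{Re}p>0$ except, possibly, at finitely many simple poles at the points $-ik_j$, $1\le j\le J$, with $k_j$ real numbers, and at points $\kappa_m$, $1\le m\le M$, with $\operatorname{Re}\kappa_m>0$, and $$\mathcal W(p)=\sum_{j=1}^J\frac{v_j}{p+ik_j}+\mathcal W_1(p)+\sum_{m=1}^M\frac{b_m}{p-\kappa_m},$$ where $v_j,b_m\in H$, and $\mathcal W_1(p)$ is an analytic ($H$-valued) function in the half-plane $\operatorname{Re}p>0$, continuous up to the imaginary axis $\sigma=0$, and satisfying $$\|\mathcal W_1(p)\|\le\frac{c}{1+|p|^\gamma},\qquad \gamma>\tfrac12,$$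 with some constant $c>0$. Assumption B: for all real numbers $k$, $$\lim_{\sigma\to0}\|\mathcal W_1(\sigma-ik)-\mathcal W_1(-ik)\|=0$$ (with $\sigma>0$). *)

(* Defs.v *)
From Stdlib Require Import Reals.
From Coquelicot Require Import Coquelicot.

Open Scope R_scope.

Set Implicit Arguments.
Unset Strict Implicit.

(* Restriction of scalars from C to R, with the same carrier, norm and uniform
   structure: derivatives and Riemann integrals in the real variable t need a
   module over R, analyticity in p needs a module over C. *)
Section Realify.
Variable H : CompleteNormedModule C_AbsRing.

Definition rscal (r : R) (x : H) : H := scal (RtoC r : C_AbsRing) x.

Lemma rscal_assoc (r s : R) (x : H) : rscal r (rscal s x) = rscal (r * s) x.
Proof.
unfold rscal; rewrite scal_assoc; f_equal.
exact (eq_sym (RtoC_mult r s)).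
Qed.

Lemma rscal_one (x : H) : rscal 1 x = x.
Proof. exact (scal_one x). Qed.

Lemma rscal_plus_r (r : R) (x y : H) :
  rscal r (plus x y) = plus (rscal r x) (rscal r y).
Proof. exact (scal_distr_l (RtoC r : C_AbsRing) x y). Qed.

Lemma rscal_plus_l (r s : R) (x : H) :
  rscal (r + s) x = plus (rscal r x) (rscal s x).
Proof.
unfold rscal; rewrite RtoC_plus.
exact (scal_distr_r (RtoC r : C_AbsRing) (RtoC s : C_AbsRing) x).
Qed.

Definition Realify_ModuleSpace_class : ModuleSpace.class_of R_Ring H :=
  ModuleSpace.Class R_Ring H
    (AbelianGroup.class H)
    (ModuleSpace.Mixin R_Ring (AbelianGroup.Pack H (AbelianGroup.class H) H)
       rscal rscal_assoc rscal_one rscal_plus_r rscal_plus_l).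

Definition Realify_NormedModuleAux_class : NormedModuleAux.class_of R_AbsRing H :=
  NormedModuleAux.Class R_AbsRing H Realify_ModuleSpace_class (UniformSpace.class H).

Definition Realify_NormedModuleAux : NormedModuleAux R_AbsRing :=
  NormedModuleAux.Pack R_AbsRing H Realify_NormedModuleAux_class H.

Lemma norm_rscal (r : R) (x : H) : norm (rscal r x) <= Rabs r * norm x.
Proof.
rewrite <- Cmod_R; exact (norm_scal (RtoC r : C_AbsRing) x).
Qed.

Definition Realify_NormedModule_mixin :
    NormedModule.mixin_of R_AbsRing Realify_NormedModuleAux :=
  NormedModule.Mixin R_AbsRing Realify_NormedModuleAux
    (@norm C_AbsRing H) (@norm_factor C_AbsRing H)
    (@norm_triangle C_AbsRing H) norm_rscal
    (@norm_compat1 C_AbsRing H) (@norm_compat2 C_AbsRing H)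
    (@norm_eq_zero C_AbsRing H).

Definition Realify : CompleteNormedModule R_AbsRing :=
  CompleteNormedModule.Pack R_AbsRing H
    (CompleteNormedModule.Class R_AbsRing H
       (NormedModule.Class R_AbsRing H Realify_NormedModuleAux_class
          Realify_NormedModule_mixin)
       (CompleteNormedModule.mixin _ _ (CompleteNormedModule.class C_AbsRing H)))
    H.

End Realify.

(* H is a Hilbert space: the complete norm of H comes from an inner product,
   linear in the first argument. *)
Record is_inner_product (H : CompleteNormedModule C_AbsRing) (ip : H -> H -> C)
    : Prop := {
  ip_plus_l : forall x y z : H, ip (plus x y) z = (ip x z + ip y z)%C;
  ip_scal_l : forall (a : C) (x y : H), ip (scal a x) y = (a * ip x y)%C;
  ip_conj : forall x y : H, ip x y = Cconj (ip y x);
  ip_norm : forall x : H, ip x x = RtoC (norm x * norm x) }.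

(* Unbounded operators: the values of the function outside of the domain are
   irrelevant. *)
Record operator (T : Type) := Operator { dom : T -> Prop; app :> T -> T }.

Section Operators.
Variable H : CompleteNormedModule C_AbsRing.
Implicit Types L : operator H.

Record linear_op L : Prop := {
  dom_zero : dom L zero;
  dom_plus : forall x y : H, dom L x -> dom L y -> dom L (plus x y);
  dom_scal : forall (a : C) (x : H), dom L x -> dom L (scal a x);
  op_plus : forall x y : H, dom L x -> dom L y -> L (plus x y) = plus (L x) (L y);
  op_scal : forall (a : C) (x : H), dom L x -> L (scal a x) = scal a (L x) }.

Definition closed_op L : Prop :=
  forall (x : nat -> H) (y z : H),
    (forall n, dom L (x n)) ->
    filterlim x eventually (locally y) ->
    filterlim (fun n => L (x n)) eventually (locally z) ->
    dom L y /\ L y = z.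

Definition densely_defined L : Prop :=
  forall (x : H) (eps : R), 0 < eps -> exists y : H, dom L y /\ norm (minus y x) < eps.

Definition shift L (p : C) (x : H) : H := plus (L x) (scal (p * p)%C x).

(* x = (L + p^2 I)^{-1} f, where (L + p^2 I)^{-1} is the inverse of an injective
   operator, defined on its range. *)
Definition is_inverse_at L (p : C) (f x : H) : Prop :=
  (forall y : H, dom L y -> shift L p y = zero -> y = zero) /\
  dom L x /\ shift L p x = f.

(* B is the everywhere defined bounded operator (L + p^2 I)^{-1}. *)
Definition is_bounded_inverse L (p : C) (B : H -> H) : Prop :=
  is_linear B /\
  (forall y : H, dom L (B y) /\ shift L p (B y) = y) /\
  (forall x : H, dom L x -> B (shift L p x) = x).

(* Complex differentiability at z in the operator norm. *)
Definition op_ex_derive (B : C -> H -> H) (z : C) : Prop :=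
  exists dB : H -> H, is_linear dB /\
    forall eps : R, 0 < eps -> exists delta : R, 0 < delta /\
      forall h : C, Cmod h < delta -> forall x : H,
        norm (minus (minus (B (z + h)%C x) (B z x)) (scal h (dB x)))
          <= eps * Cmod h * norm x.

(* p is a pole of order n of z |-> (L + z^2 I)^{-1}:
   (z - p)^n (L + z^2 I)^{-1} extends to an analytic operator function near p,
   which does not vanish at p. *)
Definition op_pole L (p : C) (n : nat) : Prop :=
  (0 < n)%nat /\
  exists (r : R) (B : C -> H -> H),
    0 < r /\
    (forall z : C, Cmod (z - p) < r -> is_linear (B z) /\ op_ex_derive B z) /\
    (forall z : C, z <> p -> Cmod (z - p) < r ->
       is_bounded_inverse L z (fun x => scal (/ (z - p) ^ n)%C (B z x))) /\
    (exists x : H, B p x <> zero).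

(* The same for the H-valued function z |-> (L + z^2 I)^{-1} f. *)
Definition elt_pole L (f : H) (p : C) (n : nat) : Prop :=
  (0 < n)%nat /\
  exists (r : R) (G : C -> H),
    0 < r /\
    (forall z : C, Cmod (z - p) < r -> ex_derive (K := C_AbsRing) G z) /\
    (forall z : C, z <> p -> Cmod (z - p) < r ->
       is_inverse_at L z f (scal (/ (z - p) ^ n)%C (G z))) /\
    G p <> zero.

Definition generic L (f : H) : Prop :=
  forall (p : C) (n : nat), op_pole L p n -> elt_pole L f p n.

(* u'' + L u = g for t > 0, u(0) = u0, u'(0) = u1, the last derivative being
   one-sided. *)
Definition is_solution L (g : R -> H) (u0 u1 : H) (u : R -> H) : Prop :=
  (exists du ddu : R -> H, forall t : R, 0 < t ->
     is_derive (K := R_AbsRing) (V := Realify H) u t (du t) /\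
     is_derive (K := R_AbsRing) (V := Realify H) du t (ddu t) /\
     dom L (u t) /\ plus (ddu t) (L (u t)) = g t) /\
  u 0 = u0 /\
  filterlim (fun t : R => scal (RtoC (/ t)) (minus (u t) (u 0))) (at_right 0) (locally u1).

Definition exp_bounded (u : R -> H) : Prop :=
  exists c a : R, 0 < c /\ 0 <= a /\ forall t : R, 0 <= t -> norm (u t) <= c * exp (a * t).

Definition integral (u : R -> H) (a b : R) : H := RInt (V := Realify H) u a b.

Definition cis (theta : R) : C := (cos theta, sin theta).

Definition assumption_A L (f : H) (J : nat) (k : nat -> R) (v : nat -> H)
    (M : nat) (kappa : nat -> C) (b : nat -> H) (W W1 : C -> H) : Prop :=
  (forall m : nat, (1 <= m <= M)%nat -> 0 < Re (kappa m)) /\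
  (forall p : C, 0 < Re p -> (forall m : nat, (1 <= m <= M)%nat -> p <> kappa m) ->
     is_inverse_at L p f (W p) /\
     W p = plus (plus (sum_n_m (fun j => scal (/ (p + Ci * RtoC (k j)))%C (v j)) 1 J)
                      (W1 p))
                (sum_n_m (fun m => scal (/ (p - kappa m))%C (b m)) 1 M)) /\
  (forall p : C, 0 < Re p -> ex_derive (K := C_AbsRing) W1 p) /\
  (forall p : C, 0 <= Re p ->
     filterlim W1 (within (fun q : C => 0 <= Re q) (locally p)) (locally (W1 p))) /\
  (exists c gamma : R, 0 < c /\ 1 / 2 < gamma /\
     forall p : C, 0 < Re p -> norm (W1 p) <= c / (1 + Rpower (Cmod p) gamma)).

Definition assumption_B (W1 : C -> H) : Prop :=
  forall k : R,
    filterlim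
      (fun sigma : R =>
         norm (minus (W1 (RtoC sigma - Ci * RtoC k)%C) (W1 (- (Ci * RtoC k))%C)))
      (at_right 0) (locally 0).

End Operators.

(* Main.v *)
Require Import Defs.
From Stdlib Require Import Reals Lra Lia List ClassicalEpsilon.
From Coquelicot Require Import Coquelicot.

Open Scope R_scope.

(** The limiting amplitude is the boundary value at [p = - i k], from the right
    half-plane, of [W p = (L + p^2)^{-1} f].

    By Duhamel's formula, [exp (i k s) u s] is the primitive of [exp (i k s) w s].
    Hence the mean in the theorem is [1 / t] times the double primitive of
    [exp (i k s) w s], whose Laplace transform is [W (p - i k) / p^2]. Since the
    primitive of [w] grows slower than any exponential, [W] is the transform of [w]
    up to the imaginary axis ([impulse_laplace]), so that it may be used on the
    line [Re p = 1 / t]. The poles on the imaginary axis are removed by subtracting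
    a trigonometric sum, the mean of which is explicit ([trig_sum]). The rest,
    [Phi p], is bounded in a strip [0 < Re p < s0] and tends to some [Phi0] as
    [p] tends to [0]; the poles with positive real part are outside of the strip.
    With [p = q / t], the inversion formula on this line would give
    [1 / (2 i pi)] times the integral of [exp q * Phi (q / t) / q^2] over
    [Re q = 1] for the mean of the rest, and this tends to [Phi0] by dominated
    convergence.

    This computation is made in [cesaro_of_laplace], with an inequality in place of
    the inversion formula: [laplace_line_bound] bounds a curve at one point by a
    bound of its transform on a vertical line, which is proved by testing the
    curve against Fejer kernels. With the bound [0] it is the uniqueness theorem
    for the Laplace transform, from which [duhamel] follows by comparing the
    transforms of the two sides.

    Transforming the equation requires some care, because the second derivative
    of a solution need not be integrable, and its first derivative may be
    unbounded near [t = 0]. What is transformed is the twice integrated equation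
    [solution_mild], which involves continuous curves only. It rests on
    [graph_increment] and [graph_second_increment]: a curve the velocity of which
    stays in the closed graph of [L] has its increments there.

    Finally the boundary value solves the equation because [W (s - i k)] does so
    with [p = s - i k], and the graph of [L] is closed. *)

Section RealifiedSpace.
Variable H : CompleteNormedModule C_AbsRing.
Notation V := (Realify H).

(** * Complex multiples in the realified space *)

(** Vectors are kept in the real space, where curves are differentiated and
    integrated; this is the complex scalar multiplication seen from there. *)
Definition cmul (c : C) (x : V) : V := @scal C_AbsRing H c x.

Lemma cmul_plus_r (c : C) (x y : V) : cmul c (plus x y) = plus (cmul c x) (cmul c y).
Proof. exact (scal_distr_l (V := H) (c : C_AbsRing) x y). Qed.

Lemma cmul_plus_l (c d : C) (x : V) : cmul (c + d) x = plus (cmul c x) (cmul d x).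
Proof. exact (scal_distr_r (V := H) (c : C_AbsRing) d x). Qed.

Lemma cmul_assoc (c d : C) (x : V) : cmul c (cmul d x) = cmul (c * d) x.
Proof. exact (scal_assoc (V := H) (c : C_AbsRing) d x). Qed.

Lemma cmul_1 (x : V) : cmul 1 x = x.
Proof. exact (scal_one (V := H) x). Qed.

Lemma cmul_0_l (x : V) : cmul 0 x = zero.
Proof. exact (scal_zero_l (V := H) x). Qed.

Lemma cmul_0_r (c : C) : cmul c (zero : V) = zero.
Proof. exact (scal_zero_r (V := H) (c : C_AbsRing)). Qed.

Lemma cmul_opp (x : V) : cmul (- (1)) x = opp x.
Proof. exact (scal_opp_one (V := H) x). Qed.

Lemma cmul_RtoC (r : R) (x : V) : cmul (RtoC r) x = scal r x.
Proof. reflexivity. Qed.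

Lemma norm_cmul_le (c : C) (x : V) : norm (cmul c x) <= Cmod c * norm x.
Proof. exact (norm_scal (V := H) (c : C_AbsRing) x). Qed.

Lemma norm_cmul (c : C) (x : V) : norm (cmul c x) = Cmod c * norm x.
Proof.
apply Rle_antisym; [apply norm_cmul_le|].
destruct (Ceq_dec c 0) as [->|Hc].
- rewrite Cmod_0, Rmult_0_l; apply norm_ge_0.
- assert (Hp : 0 < Cmod c) by now apply Cmod_gt_0.
  replace x with (cmul (/ c) (cmul c x)) at 1
    by (rewrite cmul_assoc, Cinv_l, cmul_1; auto).
  apply Rle_trans with (Cmod c * (Cmod (/ c) * norm (cmul c x))).
  + apply Rmult_le_compat_l; [lra|apply norm_cmul_le].
  + rewrite Cmod_inv by auto; right; field; lra.
Qed.

Lemma norm_plus_le (x y : V) : norm (plus x y) <= norm x + norm y.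
Proof. exact (norm_triangle (V := V) x y). Qed.

Lemma norm_0 : norm (zero : V) = 0.
Proof. exact (norm_zero (V := V)). Qed.

Lemma norm_minus_le (x y : V) : norm (minus x y) <= norm x + norm y.
Proof. unfold minus; rewrite <- (norm_opp (V := V) y); apply norm_plus_le. Qed.

Lemma norm_minus_0 (x : V) : norm (minus x zero) = norm x.
Proof. exact (f_equal norm (minus_zero_r (G := V) x)). Qed.

(** ** Deciding linear identities

    An equation between linear combinations of vectors follows from the
    equality of the coefficients; the tactic [vec] reduces it to these. *)
Inductive vexp :=
  | VVar (n : nat) | VZero | VPlus (a b : vexp) | VOpp (a : vexp)
  | VMul (c : C) (a : vexp).

Fixpoint veval (env : list V) (e : vexp) : V :=
  match e with
  | VVar n => nth n env zero
  | VZero => zero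
  | VPlus a b => plus (veval env a) (veval env b)
  | VOpp a => opp (veval env a)
  | VMul c a => cmul c (veval env a)
  end.

Fixpoint vcoef (e : vexp) (n : nat) : C :=
  match e with
  | VVar m => if Nat.eqb n m then RtoC 1 else RtoC 0
  | VZero => RtoC 0
  | VPlus a b => Cplus (vcoef a n) (vcoef b n)
  | VOpp a => Copp (vcoef a n)
  | VMul c a => Cmult c (vcoef a n)
  end.

Fixpoint vlin (c : nat -> C) (env : list V) : V :=
  match env with
  | nil => zero
  | x :: l => plus (cmul (c O) x) (vlin (fun n => c (S n)) l)
  end.

Fixpoint vsame (c d : nat -> C) (env : list V) : Prop :=
  match env with
  | nil => True
  | x :: l => c O = d O /\ vsame (fun n => c (S n)) (fun n => d (S n)) l
  end.

Lemma vlin_ext (env : list V) : forall c d, vsame c d env -> vlin c env = vlin d env.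
Proof.
induction env as [|x l IH]; intros c d; simpl; auto.
intros [E Es]; rewrite E, (IH _ _ Es); reflexivity.
Qed.

Lemma vlin_zero (env : list V) : vlin (fun _ => RtoC 0) env = zero.
Proof.
induction env as [|x l IH]; simpl; auto.
now rewrite IH, cmul_0_l, plus_zero_l.
Qed.

Lemma vlin_plus (env : list V) : forall c d,
  vlin (fun n => c n + d n)%C env = plus (vlin c env) (vlin d env).
Proof.
induction env as [|x l IH]; intros c d; simpl; [now rewrite plus_zero_l|].
rewrite IH, cmul_plus_l, <- !plus_assoc; f_equal.
rewrite !plus_assoc; f_equal; apply plus_comm.
Qed.

Lemma vlin_mul (env : list V) (k : C) : forall c,
  vlin (fun n => k * c n)%C env = cmul k (vlin c env).
Proof.
induction env as [|x l IH]; intros c; simpl; [now rewrite cmul_0_r|].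
now rewrite IH, cmul_plus_r, cmul_assoc.
Qed.

Lemma vlin_var (env : list V) : forall m,
  vlin (fun n => if Nat.eqb n m then RtoC 1 else RtoC 0) env = nth m env zero.
Proof.
induction env as [|x l IH]; intros [|m]; simpl; auto.
- rewrite cmul_1, vlin_zero, plus_zero_r; reflexivity.
- rewrite cmul_0_l, plus_zero_l; apply IH.
Qed.

Lemma veval_vlin (env : list V) (e : vexp) : veval env e = vlin (vcoef e) env.
Proof.
induction e as [m| |a IHa b IHb|a IHa|c a IHa]; simpl.
- now rewrite vlin_var.
- now rewrite vlin_zero.
- now rewrite vlin_plus, IHa, IHb.
- rewrite IHa, <- cmul_opp, <- vlin_mul; apply vlin_ext.
  generalize (vcoef a); clear; induction env as [|x l IH]; intros c; simpl; auto.
  split; [ring|apply (IH (fun n => c (S n)))].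
- now rewrite vlin_mul, IHa.
Qed.

Lemma veval_eq (env : list V) (a b : vexp) :
  vsame (vcoef a) (vcoef b) env -> veval env a = veval env b.
Proof. rewrite !veval_vlin; apply vlin_ext. Qed.


Ltac vec_mem x l :=
  match l with
  | nil => constr:(false)
  | x :: _ => constr:(true)
  | _ :: ?t => vec_mem x t
  end.
Ltac vec_idx x l :=
  match l with
  | x :: _ => constr:(O)
  | _ :: ?t => let n := vec_idx x t in constr:(S n)
  end.
Ltac vec_env e l :=
  match e with
  | @plus _ ?a ?b => let l := vec_env a l in vec_env b l
  | @minus _ ?a ?b => let l := vec_env a l in vec_env b l
  | @opp _ ?a => vec_env a l
  | @zero _ => l
  | cmul _ ?a => vec_env a l
  | @scal _ _ _ ?a => vec_env a l
  | _ => match vec_mem e l with true => l | false => constr:(e :: l) end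
  end.
Ltac vec_reify e l :=
  match e with
  | @plus _ ?a ?b =>
      let a := vec_reify a l in let b := vec_reify b l in constr:(VPlus a b)
  | @minus _ ?a ?b =>
      let a := vec_reify a l in let b := vec_reify b l in constr:(VPlus a (VOpp b))
  | @opp _ ?a => let a := vec_reify a l in constr:(VOpp a)
  | @zero _ => constr:(VZero)
  | cmul ?c ?a => let a := vec_reify a l in constr:(VMul c a)
  | @scal R_AbsRing _ ?c ?a => let a := vec_reify a l in constr:(VMul (RtoC c) a)
  | @scal R_Ring _ ?c ?a => let a := vec_reify a l in constr:(VMul (RtoC c) a)
  | @scal _ _ ?c ?a => let a := vec_reify a l in constr:(VMul c a)
  | _ => let n := vec_idx e l in constr:(VVar n)
  end.
Ltac vec :=
  cbv beta;
  match goal with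
  | |- @eq _ ?a ?b =>
      let l := vec_env a (@nil V) in
      let l := vec_env b l in
      let ea := vec_reify a l in let eb := vec_reify b l in
      change (veval l ea = veval l eb);
      apply veval_eq; cbn [vsame vcoef Nat.eqb];
      repeat split;
      rewrite ?RtoC_plus, ?RtoC_minus, ?RtoC_opp, ?RtoC_mult;
      try ring
  end.

(** * Exponentials, primitives and growth of curves *)

Lemma ball_Rabs (x e y : R) : ball x e y -> Rabs (y - x) < e.
Proof. exact (fun h => h). Qed.

(** [exp (p t)], by Euler's formula. *)
Definition cexp (p : C) (t : R) : C :=
  (exp (Re p * t) * cos (Im p * t), exp (Re p * t) * sin (Im p * t)).

Lemma cexp_0_r (p : C) : cexp p 0 = 1.
Proof. unfold cexp; rewrite !Rmult_0_r, exp_0, cos_0, sin_0; unfold RtoC; f_equal; ring. Qed.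

Lemma cexp_0_l (t : R) : cexp 0 t = 1.
Proof. unfold cexp; simpl; rewrite !Rmult_0_l, exp_0, cos_0, sin_0; unfold RtoC; f_equal; ring. Qed.

Lemma cexp_plus (p q : C) (t : R) : (cexp p t * cexp q t)%C = cexp (p + q) t.
Proof.
unfold cexp, Cmult; destruct p as [a b], q as [c d]; simpl.
rewrite !(Rmult_plus_distr_r _ _ t), exp_plus, cos_plus, sin_plus; f_equal; ring.
Qed.

Lemma Cmod_cexp (p : C) (t : R) : Cmod (cexp p t) = exp (Re p * t).
Proof.
unfold Cmod, cexp; simpl fst; simpl snd.
set (e := exp _).
replace ((e * cos (Im p * t)) ^ 2 + (e * sin (Im p * t)) ^ 2)
  with (e ^ 2 * (Rsqr (sin (Im p * t)) + Rsqr (cos (Im p * t))))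
  by (unfold Rsqr; ring).
rewrite sin2_cos2, Rmult_1_r; apply sqrt_pow2; left; apply exp_pos.
Qed.

Lemma cexp_imaginary (y t : R) : cexp (Ci * y) t = cis (y * t).
Proof.
unfold cexp, cis, Ci, RtoC, Cmult; simpl.
replace (0 * y - 1 * 0) with 0 by ring; replace (0 * 0 + 1 * y) with y by ring.
rewrite Rmult_0_l, exp_0; f_equal; ring.
Qed.

Lemma cmul_split (c : C) (x : V) :
  cmul c x = plus (scal (Re c) x) (scal (Im c) (cmul Ci x)).
Proof.
vec; destruct c as [a b]; unfold RtoC, Ci, Cmult, Cplus; simpl; f_equal; ring.
Qed.

Lemma norm_minus_sym (x y : V) : norm (minus x y) = norm (minus y x).
Proof.
transitivity (norm (cmul (- (1)) (minus y x))); [f_equal; vec|].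
rewrite norm_cmul, Cmod_opp, Cmod_1; apply Rmult_1_l.
Qed.

Lemma is_linear_cmul (c : C) : is_linear (cmul c : V -> V).
Proof.
split.
- apply cmul_plus_r.
- intros k x; vec.
- exists (Cmod c + 1); split; [pose proof (Cmod_ge_0 c); lra|].
  intros x; eapply Rle_trans; [apply norm_cmul_le|].
  apply Rmult_le_compat_r; [apply norm_ge_0|lra].
Qed.

Lemma continuous_cmul (c : C) (x : R -> V) (t : R) :
  continuous x t -> continuous (fun s => cmul c (x s)) t.
Proof.
intros Hx; apply (continuous_comp x (cmul c)); auto.
apply (filterdiff_continuous (U := V) (V := V) (cmul c)).
exists (cmul c); apply filterdiff_linear, is_linear_cmul.
Qed.

Lemma is_derive_cmul (c : C) (x : R -> V) (t : R) (l : V) :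
  is_derive x t l -> is_derive (fun s => cmul c (x s)) t (cmul c l).
Proof.
intros Hx.
eapply filterdiff_ext_lin.
- apply (filterdiff_comp (V := V) (W := V) x (cmul c) (fun s => scal s l) (cmul c));
    [exact Hx|].
  apply filterdiff_linear, is_linear_cmul.
- intros s; simpl; vec.
Qed.

Lemma is_derive_scal_curve (a : R -> R) (x : R -> V) (t a' : R) (x' : V) :
  is_derive a t a' -> is_derive x t x' ->
  is_derive (fun s => scal (a s) (x s)) t (plus (scal a' (x t)) (scal (a t) x')).
Proof.
intros Ha Hx.
eapply filterdiff_ext_lin.
- apply (filterdiff_scal_fct t a x); [exact Rmult_comm|exact Ha|exact Hx].
- intros s; simpl; unfold scal at 2; simpl; unfold mult; simpl; vec.
Qed.

Lemma is_derive_cexp_cmul (p : C) (x : R -> V) (t : R) (l : V) :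
  is_derive x t l ->
  is_derive (fun s => cmul (cexp p s) (x s)) t
    (plus (cmul (p * cexp p t) (x t)) (cmul (cexp p t) l)).
Proof.
intros Hx.
apply is_derive_ext with
  (f := fun s => plus (scal (Re (cexp p s)) (x s)) (scal (Im (cexp p s)) (cmul Ci (x s)))).
{ intros s; symmetry; apply cmul_split. }
evar_last.
- apply (is_derive_plus (V := V)); apply is_derive_scal_curve.
  + unfold cexp; simpl; auto_derive; [exact I|reflexivity].
  + exact Hx.
  + unfold cexp; simpl; auto_derive; [exact I|reflexivity].
  + apply is_derive_cmul, Hx.
- vec; destruct p as [a b]; unfold cexp, RtoC, Ci, Cmult, Cplus; simpl; f_equal; ring.
Qed.

Lemma continuous_cexp_cmul (p : C) (x : R -> V) (t : R) :
  continuous x t -> continuous (fun s => cmul (cexp p s) (x s)) t.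
Proof.
intros Hx.
apply continuous_ext with
  (f := fun s => plus (scal (Re (cexp p s)) (x s)) (scal (Im (cexp p s)) (cmul Ci (x s)))).
{ intros s; symmetry; apply cmul_split. }
apply (continuous_plus (V := V)); apply (continuous_scal (V := V)).
- apply (ex_derive_continuous (V := R_NormedModule)); unfold cexp; simpl; auto_derive; exact I.
- exact Hx.
- apply (ex_derive_continuous (V := R_NormedModule)); unfold cexp; simpl; auto_derive; exact I.
- apply continuous_cmul, Hx.
Qed.

(** ** Primitives of continuous curves *)

Definition prim (x : R -> V) (t : R) : V := RInt x 0 t.

Definition cont (x : R -> V) : Prop := forall t, continuous x t.

Lemma cont_ex_RInt (x : R -> V) (a b : R) : cont x -> ex_RInt x a b.
Proof. intros Hx; apply ex_RInt_continuous; intros; apply Hx. Qed.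

Lemma prim_derive (x : R -> V) (t : R) : cont x -> is_derive (prim x) t (x t).
Proof.
intros Hx; apply (is_derive_RInt x (prim x) 0); [|apply Hx].
apply filter_forall; intros s; apply (RInt_correct (V := V)), cont_ex_RInt, Hx.
Qed.

Lemma prim_cont (x : R -> V) : cont x -> cont (prim x).
Proof.
intros Hx t; apply (ex_derive_continuous (V := V)); exists (x t); now apply prim_derive.
Qed.

Lemma prim_0 (x : R -> V) : prim x 0 = zero.
Proof. apply (RInt_point (V := V)). Qed.

Lemma prim_unique (x X : R -> V) (t : R) :
  cont x -> (forall s, is_derive X s (x s)) -> prim x t = minus (X t) (X 0).
Proof.
intros Hx HX; apply (is_RInt_unique (V := V)).
apply (is_RInt_derive (V := V)); intros; [apply HX|apply Hx].
Qed.

Lemma prim_ext (x y : R -> V) (t : R) :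
  0 <= t -> (forall s, 0 < s < t -> x s = y s) -> prim x t = prim y t.
Proof.
intros Ht E; apply (RInt_ext (V := V)); intros s.
rewrite Rmin_left, Rmax_right by auto; apply E.
Qed.

Lemma prim_ext_all (x y : R -> V) (t : R) : (forall s, x s = y s) -> prim x t = prim y t.
Proof. intros E; apply (RInt_ext (V := V)); auto. Qed.

Lemma prim_plus (x y : R -> V) (t : R) :
  cont x -> cont y -> prim (fun s => plus (x s) (y s)) t = plus (prim x t) (prim y t).
Proof. intros; apply (RInt_plus (V := V)); now apply cont_ex_RInt. Qed.

Lemma prim_cmul (c : C) (x : R -> V) (t : R) :
  cont x -> prim (fun s => cmul c (x s)) t = cmul c (prim x t).
Proof.
intros Hx; rewrite (@prim_unique _ (fun s => cmul c (prim x s))).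
- rewrite prim_0, cmul_0_r; vec.
- intros s; apply continuous_cmul, Hx.
- intros s; apply is_derive_cmul, prim_derive, Hx.
Qed.

(** What replaces absolute convergence when only the primitive of [x] is
    controlled. *)
Lemma prim_cexp_parts (p : C) (x : R -> V) (t : R) :
  cont x ->
  prim (fun s => cmul (cexp p s) (x s)) t =
  minus (cmul (cexp p t) (prim x t))
        (cmul p (prim (fun s => cmul (cexp p s) (prim x s)) t)).
Proof.
intros Hx.
assert (Hc : cont (fun s => cmul (cexp p s) (prim x s)))
  by (intros s; apply continuous_cexp_cmul, prim_cont, Hx).
rewrite (@prim_unique _ (fun s => minus (cmul (cexp p s) (prim x s))
        (cmul p (prim (fun s => cmul (cexp p s) (prim x s)) s)))).
- rewrite !prim_0; vec.
- intros s; apply continuous_cexp_cmul, Hx.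
- intros s; evar_last.
  + apply (is_derive_minus (V := V)).
    * apply is_derive_cexp_cmul, prim_derive, Hx.
    * apply is_derive_cmul, (prim_derive _ _ Hc).
  + simpl; vec.
Qed.

Lemma norm_RInt_le_RInt (x : R -> V) (g : R -> R) (a b : R) :
  a <= b -> cont x -> (forall t, continuous g t) ->
  (forall t, a <= t <= b -> norm (x t) <= g t) -> norm (RInt x a b) <= RInt g a b.
Proof.
intros Hab Hx Hg Hle.
apply (norm_RInt_le (V := V) x g a b); auto.
- apply (RInt_correct (V := V)), cont_ex_RInt, Hx.
- apply (RInt_correct (V := R_CompleteNormedModule)), (ex_RInt_continuous (V := R_CompleteNormedModule)); auto.
Qed.

Lemma RInt_exp (a s t : R) :
  a <> 0 -> RInt (fun r => exp (a * r)) s t = (exp (a * t) - exp (a * s)) / a.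
Proof.
intros Ha; apply is_RInt_unique.
replace ((exp (a * t) - exp (a * s)) / a)
  with (minus (exp (a * t) / a) (exp (a * s) / a)) by (unfold minus, plus, opp; simpl; field; auto).
apply (is_RInt_derive (V := R_CompleteNormedModule) (fun r => exp (a * r) / a)); intros r _.
- auto_derive; auto; field; auto.
- apply (ex_derive_continuous (V := R_NormedModule)); auto_derive; auto.
Qed.

Lemma continuous_exp_lin (c a t : R) : continuous (fun s => c * exp (a * s)) t.
Proof. apply (ex_derive_continuous (V := R_NormedModule)); auto_derive; auto. Qed.

Definition growth (beta : R) (x : R -> V) : Prop :=
  exists c, 0 <= c /\ forall t, 0 <= t -> norm (x t) <= c * exp (beta * t).

Lemma norm_RInt_growth (x : R -> V) (beta c s t : R) :
  beta <> 0 -> s <= t -> cont x ->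
  (forall r, s <= r <= t -> norm (x r) <= c * exp (beta * r)) ->
  norm (RInt x s t) <= c * ((exp (beta * t) - exp (beta * s)) / beta).
Proof.
intros Hb Hst Hx Hle.
rewrite <- RInt_exp by auto.
rewrite <- (RInt_scal (V := R_CompleteNormedModule)) by
  (apply (ex_RInt_continuous (V := R_CompleteNormedModule)); intros r _;
   apply (ex_derive_continuous (V := R_NormedModule)); auto_derive; auto).
apply norm_RInt_le_RInt; auto; apply continuous_exp_lin.
Qed.

Lemma growth_prim (beta : R) (x : R -> V) :
  0 < beta -> cont x -> growth beta x -> growth beta (prim x).
Proof.
intros Hb Hx [c [Hc Hle]]; exists (c / beta); split.
- apply Rdiv_le_0_compat; lra.
- intros t Ht; eapply Rle_trans; [apply (norm_RInt_growth _ beta c); auto; [lra|intros r Hr; apply Hle; lra]|].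
  rewrite Rmult_0_r, exp_0.
  replace (c / beta * exp (beta * t)) with (c * (exp (beta * t) / beta)) by (field; lra).
  apply Rmult_le_compat_l; auto.
  apply Rmult_le_compat_r; [left; apply Rinv_0_lt_compat; lra|lra].
Qed.

Lemma growth_weaken (beta beta' : R) (x : R -> V) :
  beta <= beta' -> growth beta x -> growth beta' x.
Proof.
intros Hb [c [Hc Hle]]; exists c; split; auto; intros t Ht.
eapply Rle_trans; [apply Hle, Ht|].
apply Rmult_le_compat_l; auto.
destruct (Rle_lt_or_eq_dec (beta * t) (beta' * t)) as [Hlt| ->]; [nra| |lra].
left; now apply exp_increasing.
Qed.

Lemma growth_plus (beta : R) (x y : R -> V) :
  growth beta x -> growth beta y -> growth beta (fun t => plus (x t) (y t)).
Proof.
intros [c [Hc Hx]] [d [Hd Hy]]; exists (c + d); split; [lra|]; intros t Ht.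
eapply Rle_trans; [apply norm_plus_le|].
specialize (Hx t Ht); specialize (Hy t Ht); lra.
Qed.

Lemma growth_cmul (beta : R) (c : C) (x : R -> V) :
  growth beta x -> growth beta (fun t => cmul c (x t)).
Proof.
intros [d [Hd Hx]]; exists (Cmod c * d); split.
- apply Rmult_le_pos; auto; apply Cmod_ge_0.
- intros t Ht; rewrite norm_cmul, Rmult_assoc.
  apply Rmult_le_compat_l; [apply Cmod_ge_0|auto].
Qed.

Lemma growth_cexp_cmul (beta : R) (p : C) (x : R -> V) :
  growth beta x -> growth (Re p + beta) (fun t => cmul (cexp p t) (x t)).
Proof.
intros [d [Hd Hx]]; exists d; split; auto; intros t Ht.
rewrite norm_cmul, Cmod_cexp, Rmult_plus_distr_r, exp_plus.
pose proof (exp_pos (Re p * t)); specialize (Hx t Ht); nra.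
Qed.

Lemma growth_cexp_const (p : C) (v : V) : growth (Re p) (fun t => cmul (cexp p t) v).
Proof.
exists (norm v); split; [apply norm_ge_0|]; intros t _.
rewrite norm_cmul, Cmod_cexp; lra.
Qed.

Lemma growth_ext (beta : R) (x y : R -> V) :
  (forall t, 0 <= t -> x t = y t) -> growth beta x -> growth beta y.
Proof. intros E [c [Hc Hx]]; exists c; split; auto; intros t Ht; rewrite <- E; auto. Qed.

(** A modulated curve has a primitive of the same growth as long as the
    modulation does not grow; the factor [t] produced by the integral is absorbed
    in the exponential because the rate is positive. *)
Lemma growth_prim_cexp (beta : R) (p : C) (x : R -> V) :
  0 < beta -> Re p = 0 -> cont x -> growth beta (prim x) ->
  growth beta (prim (fun t => cmul (cexp p t) (x t))).
Proof.
intros Hb Hp Hx HX.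
assert (Hg : growth beta (fun t => cmul (cexp p t) (prim x t))).
{ replace beta with (Re p + beta) by (rewrite Hp; ring); now apply growth_cexp_cmul. }
apply growth_ext with (x := fun t => plus (cmul (cexp p t) (prim x t))
  (cmul (- p) (prim (fun s => cmul (cexp p s) (prim x s)) t))).
- intros t _; rewrite (prim_cexp_parts p x t Hx); vec.
- apply growth_plus; auto; apply growth_cmul, growth_prim; auto.
  intros s; apply continuous_cexp_cmul, prim_cont, Hx.
Qed.

(** * Curves in the graph of a closed operator *)

Lemma filterlim_norm {T : Type} (F : (T -> Prop) -> Prop) {FF : Filter F}
  (x : T -> V) (l : V) :
  filterlim x F (locally l) <->
  (forall eps, 0 < eps -> F (fun t => norm (minus (x t) l) < eps)).
Proof.
rewrite (filterlim_locally_ball_norm (U := V)); split.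
- intros Hx eps He; exact (Hx (mkposreal eps He)).
- intros Hx eps; exact (Hx eps (cond_pos eps)).
Qed.

Lemma lim_plus {T : Type} (F : (T -> Prop) -> Prop) {FF : Filter F} (x y : T -> V) (l m : V) :
  filterlim x F (locally l) -> filterlim y F (locally m) ->
  filterlim (fun t => plus (x t) (y t)) F (locally (plus l m)).
Proof.
intros Hx Hy; eapply filterlim_comp_2; [exact Hx|exact Hy|].
exact (filterlim_plus (V := V) l m).
Qed.

Lemma lim_scal {T : Type} (F : (T -> Prop) -> Prop) {FF : Filter F}
  (a : T -> R) (x : T -> V) (a0 : R) (l : V) :
  filterlim a F (locally a0) -> filterlim x F (locally l) ->
  filterlim (fun t => scal (a t) (x t)) F (locally (scal a0 l)).
Proof.
intros Ha Hx; eapply filterlim_comp_2; [exact Ha|exact Hx|].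
exact (filterlim_scal (V := V) a0 l).
Qed.

Lemma lim_cmul {T : Type} (F : (T -> Prop) -> Prop) {FF : Filter F}
  (a : T -> C) (x : T -> V) (a0 : C) (l : V) :
  filterlim a F (locally a0) -> filterlim x F (locally l) ->
  filterlim (fun t => cmul (a t) (x t)) F (locally (cmul a0 l)).
Proof.
intros Ha Hx.
apply (filterlim_comp_2 (G := locally (a0 : AbsRing_UniformSpace C_AbsRing)) (H := locally (l : H))
  a x (fun c (y : V) => cmul c y)).
- intros P HP; apply Ha, locally_C, HP.
- exact Hx.
- exact (filterlim_scal (V := H) (a0 : C_AbsRing) l).
Qed.

Lemma lim_minus {T : Type} (F : (T -> Prop) -> Prop) {FF : Filter F} (x y : T -> V) (l m : V) :
  filterlim x F (locally l) -> filterlim y F (locally m) ->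
  filterlim (fun t => minus (x t) (y t)) F (locally (minus l m)).
Proof.
intros Hx Hy; apply lim_plus; auto.
eapply filterlim_comp; [exact Hy|]; exact (filterlim_opp (V := V) m).
Qed.

Lemma is_derive_norm (x : R -> V) (t : R) (l : V) (eps : R) :
  is_derive x t l -> 0 < eps ->
  exists delta, 0 < delta /\ forall s, Rabs (s - t) < delta ->
    norm (minus (minus (x s) (x t)) (scal (s - t) l)) <= eps * Rabs (s - t).
Proof.
intros [_ Hx] He.
destruct (Hx t (fun P HP => HP) (mkposreal eps He)) as [d Hd].
exists d; split; [apply cond_pos|]; intros s Hs; exact (Hd s Hs).
Qed.

Section Graph.
Variable L : operator H.
Hypothesis Llin : linear_op L.
Hypothesis Lclosed : closed_op L.

Definition graph (x y : V) : Prop := dom L x /\ L x = y.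

Lemma graph_zero : graph zero zero.
Proof.
split; [exact (dom_zero Llin)|].
pose proof (op_scal Llin (RtoC 0) (dom_zero Llin)) as E.
rewrite (scal_zero_l (V := H)) in E; exact (eq_trans E (scal_zero_l (V := H) _)).
Qed.

Lemma graph_plus (x y x' y' : V) : graph x y -> graph x' y' -> graph (plus x x') (plus y y').
Proof.
intros [Dx Ex] [Dx' Ex']; split; [exact (dom_plus Llin Dx Dx')|].
rewrite <- Ex, <- Ex'; exact (op_plus Llin Dx Dx').
Qed.

Lemma graph_cmul (c : C) (x y : V) : graph x y -> graph (cmul c x) (cmul c y).
Proof.
intros [Dx Ex]; split; [exact (dom_scal Llin c Dx)|].
rewrite <- Ex; exact (op_scal Llin c Dx).
Qed.

Lemma graph_closed (x y : V) :
  (forall eps, 0 < eps -> exists x' y', graph x' y' /\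
     norm (minus x' x) <= eps /\ norm (minus y' y) <= eps) -> graph x y.
Proof.
intros Happ.
assert (Hn : forall n : nat, 0 < / (INR n + 1))
  by (intros n; apply Rinv_0_lt_compat; pose proof (pos_INR n); lra).
set (Q := fun (n : nat) (a : V) => exists y', graph a y' /\
  norm (minus a x) <= / (INR n + 1) /\ norm (minus y' y) <= / (INR n + 1)).
assert (HQ : forall n, exists a, Q n a) by (intros n; exact (Happ _ (Hn n))).
set (a := fun n => proj1_sig (constructive_indefinite_description _ (HQ n))).
assert (Ha : forall n, Q n (a n))
  by (intros n; exact (proj2_sig (constructive_indefinite_description _ (HQ n)))).
assert (Hlim : forall (b : nat -> V) (l : V),
  (forall n, norm (minus (b n) l) <= / (INR n + 1)) ->
  filterlim b eventually (locally l)).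
{ intros b l Hb; apply filterlim_norm; [apply eventually_filter|]; intros eps He.
  destruct (archimed_cor1 eps He) as [N [HN HN0]]; exists N; intros n Hle.
  eapply Rle_lt_trans; [apply Hb|]; eapply Rle_lt_trans; [|exact HN].
  apply Rinv_le_contravar; [now apply lt_0_INR|apply le_INR in Hle; lra]. }
apply (Lclosed a x y).
- intros n; destruct (Ha n) as [y' [[D _] _]]; exact D.
- apply Hlim; intros n; destruct (Ha n) as [y' [_ [Hx _]]]; exact Hx.
- apply Hlim; intros n; destruct (Ha n) as [y' [[_ E] [_ Hy]]]; rewrite E; exact Hy.
Qed.

Lemma graph_lim {T : Type} (F : (T -> Prop) -> Prop) {FF : ProperFilter F}
  (x y : T -> V) (lx ly : V) :
  F (fun t => graph (x t) (y t)) ->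
  filterlim x F (locally lx) -> filterlim y F (locally ly) -> graph lx ly.
Proof.
intros HG Hx Hy; apply graph_closed; intros eps He.
assert (FF' := filter_filter (F := F)).
pose proof (proj1 (filterlim_norm F x lx) Hx eps He) as Hx'.
pose proof (proj1 (filterlim_norm F y ly) Hy eps He) as Hy'.
destruct (filter_ex (F := F) _ (filter_and _ _ HG (filter_and _ _ Hx' Hy')))
  as [t [Gt [Xt Yt]]].
exists (x t), (y t); repeat split; try apply Gt; lra.
Qed.

(** If the velocity of a curve lies in a closed subspace at all times, so do its
    increments. The velocity is not assumed continuous, so that it need not be
    integrable; instead the times up to which the increment is approximated by
    the subspace with an error [eps] per unit of time are shown to exhaust the
    interval, by straddling their supremum. *)
Lemma graph_increment (X Y dX dY : R -> V) (a b : R) :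
  a <= b ->
  (forall s, a <= s <= b ->
     is_derive X s (dX s) /\ is_derive Y s (dY s) /\ graph (dX s) (dY s)) ->
  graph (minus (X b) (X a)) (minus (Y b) (Y a)).
Proof.
intros Hab HD.
set (P := fun eps s => exists x y, graph x y /\
  norm (minus x (minus (X s) (X a))) <= eps * (s - a) /\
  norm (minus y (minus (Y s) (Y a))) <= eps * (s - a)).
assert (HP : forall eps, 0 < eps -> P eps b).
{ intros eps He.
  set (S := fun s => a <= s <= b /\ P eps s).
  assert (Sa : S a).
  { split; [lra|]; exists zero, zero; split; [apply graph_zero|].
    assert (Hz : forall z : V, norm (minus zero (minus z z)) <= eps * (a - a)).
    { intros z; replace (minus zero (minus z z)) with (zero : V) by vec.
      right; rewrite Rminus_diag, Rmult_0_r; apply norm_0. }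
    split; apply Hz. }
  destruct (completeness S) as [m [Hub Hlub]].
  { exists b; intros s [Hs _]; lra. }
  { now exists a. }
  assert (Hm : a <= m <= b).
  { split; [now apply Hub|]; apply Hlub; intros s [Hs _]; lra. }
  destruct (HD m Hm) as [DX [DY Gm]].
  destruct (is_derive_norm _ _ _ _ DX He) as [d1 [Hd1 B1]].
  destruct (is_derive_norm _ _ _ _ DY He) as [d2 [Hd2 B2]].
  set (d := Rmin d1 d2).
  assert (Hd : 0 < d) by now apply Rmin_glb_lt.
  assert (Hdd1 : d <= d1) by apply Rmin_l.
  assert (Hdd2 : d <= d2) by apply Rmin_r.
  assert (Hs : exists s, S s /\ m - d < s).
  { apply Classical_Prop.NNPP; intros Hno.
    assert (m <= m - d); [|lra].
    apply Hlub; intros s Ss; apply Rnot_lt_le; intros Hlt; apply Hno; now exists s. }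
  destruct Hs as [s [[Hs [x [y [Gxy [Nx Ny]]]]] Hsm]].
  assert (Hsm' : s <= m) by (apply Hub; split; auto; now exists x, y).
  assert (Hstep : forall t, m <= t < m + d -> t <= b -> S t).
  { intros t Ht Htb; split; [lra|].
    exists (plus x (cmul (RtoC (t - s)) (dX m))), (plus y (cmul (RtoC (t - s)) (dY m))).
    split; [apply graph_plus; auto; now apply graph_cmul|].
    assert (Straddle : forall (Z : R -> V) (z l : V),
      (forall r, Rabs (r - m) < d ->
         norm (minus (minus (Z r) (Z m)) (scal (r - m) l)) <= eps * Rabs (r - m)) ->
      norm (minus z (minus (Z s) (Z a))) <= eps * (s - a) ->
      norm (minus (plus z (cmul (RtoC (t - s)) l)) (minus (Z t) (Z a))) <= eps * (t - a)).
    { intros Z z l BZ Nz.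
      replace (minus (plus z (cmul (RtoC (t - s)) l)) (minus (Z t) (Z a))) with
        (plus (minus z (minus (Z s) (Z a)))
           (minus (minus (minus (Z s) (Z m)) (scal (s - m) l))
                  (minus (minus (Z t) (Z m)) (scal (t - m) l)))) by vec.
      eapply Rle_trans; [apply norm_plus_le|].
      eapply Rle_trans; [apply Rplus_le_compat_l, norm_minus_le|].
      pose proof (BZ s ltac:(rewrite Rabs_left1; lra)) as Bs.
      pose proof (BZ t ltac:(rewrite Rabs_pos_eq; lra)) as Bt.
      rewrite Rabs_left1 in Bs by lra; rewrite Rabs_pos_eq in Bt by lra.
      lra. }
    split; apply Straddle; auto; intros r Hr; [apply B1|apply B2]; lra. }
  destruct (Rlt_le_dec m b) as [Hlt|Hle].
  - set (t := Rmin (m + d / 2) b).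
    assert (Ht : m < t) by (apply Rmin_glb_lt; lra).
    assert (Ht1 : t <= m + d / 2) by apply Rmin_l.
    assert (Ht2 : t <= b) by apply Rmin_r.
    assert (t <= m); [|lra].
    apply Hub, Hstep; lra.
  - replace b with m by lra; apply Hstep; lra. }
apply graph_closed; intros eps He.
destruct (HP (eps / (b - a + 1))) as [x [y [G [Nx Ny]]]].
{ apply Rdiv_lt_0_compat; lra. }
assert (Hle : eps / (b - a + 1) * (b - a) <= eps).
{ apply Rmult_le_reg_r with (b - a + 1); [lra|].
  replace (eps / (b - a + 1) * (b - a) * (b - a + 1)) with (eps * (b - a)) by (field; lra).
  nra. }
exists x, y; split; auto; lra.
Qed.

(** Second-order version, with initial data taken from one-sided difference
    quotients. The velocity of the curve may be unbounded near [0]; this is why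
    the acceleration is integrated against the piecewise linear weight that
    vanishes at [e] and [t] and has its peak at [2 e], which leaves only the
    difference quotient over [[e, 2 e]]. *)
Lemma graph_second_increment (X Y dX dY ddX ddY : R -> V) (x1 y1 : V) (t : R) :
  0 < t ->
  (forall s, 0 < s ->
     is_derive X s (dX s) /\ is_derive dX s (ddX s) /\
     is_derive Y s (dY s) /\ is_derive dY s (ddY s) /\ graph (ddX s) (ddY s)) ->
  filterlim (fun e => scal (/ e) (minus (X e) (X 0))) (at_right 0) (locally x1) ->
  filterlim (fun e => scal (/ e) (minus (Y e) (Y 0))) (at_right 0) (locally y1) ->
  graph (minus (minus (X t) (X 0)) (scal t x1)) (minus (minus (Y t) (Y 0)) (scal t y1)).
Proof.
intros Ht HD Lx Ly.
set (quot := fun (Z : R -> V) e => scal (/ e) (minus (Z e) (Z 0))).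
(* the weighted integral of the acceleration, in terms of difference quotients *)
set (S := fun (Z : R -> V) e => minus (minus (minus (Z t) (Z 0)) (scal (2 * e) (quot Z (2 * e))))
   (scal (t - 2 * e) (minus (scal 2 (quot Z (2 * e))) (quot Z e)))).
assert (HS : forall (Z : R -> V) (l : V),
  filterlim (quot Z) (at_right 0) (locally l) ->
  filterlim (S Z) (at_right 0) (locally (minus (minus (Z t) (Z 0)) (scal t l)))).
{ intros Z l HZ.
  assert (Hid : filterlim (fun e : R => e) (at_right 0) (locally 0))
    by (intros Q HQ; apply filter_le_within; exact HQ).
  assert (H2 : filterlim (fun e => 2 * e) (at_right 0) (locally 0)).
  { replace 0 with (2 * 0) at 2 by ring.
    apply (filterlim_comp _ _ _ (fun e : R => e) (fun e => 2 * e) _ _ _ Hid).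
    apply (continuous_scal_r (V := R_NormedModule) 2 (fun e : R => e)), continuous_id. }
  assert (H2r : filterlim (fun e => 2 * e) (at_right 0) (at_right 0)).
  { intros Q [d HQ].
    exists (pos_div_2 d); intros e He Hpos; apply HQ; [|lra].
    unfold ball in *; simpl in *; unfold AbsRing_ball, abs, minus, plus, opp in *; simpl in *.
    rewrite Rabs_pos_eq in * by lra; lra. }
  assert (HZ2 : filterlim (fun e => quot Z (2 * e)) (at_right 0) (locally l))
    by (eapply filterlim_comp; [exact H2r|exact HZ]).
  unfold S.
  replace (minus (minus (Z t) (Z 0)) (scal t l)) with
    (minus (minus (minus (Z t) (Z 0)) (scal 0 l)) (scal (t - 0) (minus (scal 2 l) l)))
    by (rewrite Rminus_0_r; vec).
  assert (FF := filter_filter (F := at_right 0)).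
  repeat first [apply lim_minus | apply lim_scal | apply filterlim_const | assumption].
  - apply (filterlim_comp _ _ _ (fun e => 2 * e) (fun e => t - e) _ _ _ H2).
    apply (ex_derive_continuous (V := R_NormedModule) (fun e => t - e) 0); auto_derive; auto. }
assert (HG : forall e, 0 < e < t / 2 -> graph (S X e) (S Y e)).
{ intros e He.
  (* an antiderivative of the weighted acceleration, for the weight [al + be s] *)
  set (A := fun al be (Z dZ : R -> V) s =>
     minus (scal (al + be * s) (dZ s)) (scal be (Z s))).
  assert (DA : forall al be (Z dZ ddZ : R -> V) s,
    is_derive Z s (dZ s) -> is_derive dZ s (ddZ s) ->
    is_derive (A al be Z dZ) s (cmul (RtoC (al + be * s)) (ddZ s))).
  { intros al be Z dZ ddZ s D1 D2; unfold A; evar_last.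
    - apply (is_derive_minus (V := V)); [|apply (is_derive_scal_curve (fun _ => be)); [|exact D1]].
      + apply is_derive_scal_curve; [|exact D2].
        auto_derive; [auto|reflexivity].
      + apply (is_derive_const (V := R_NormedModule)).
    - unfold zero at 1; simpl; vec. }
  assert (GA : forall al be a b, 0 < a <= b ->
    graph (minus (A al be X dX b) (A al be X dX a)) (minus (A al be Y dY b) (A al be Y dY a))).
  { intros al be a b Hab.
    apply graph_increment with (dX := fun s => cmul (RtoC (al + be * s)) (ddX s))
      (dY := fun s => cmul (RtoC (al + be * s)) (ddY s)); [lra|].
    intros s Hs; destruct (HD s ltac:(lra)) as [D1 [D2 [D3 [D4 G]]]].
    split; [now apply DA|split; [now apply DA|now apply graph_cmul]]. }
  set (c := (t - 2 * e) / e).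
  assert (HSA : forall (Z dZ : R -> V), S Z e =
     plus (minus (A (- c * e) c Z dZ (2 * e)) (A (- c * e) c Z dZ e))
          (minus (A t (- 1) Z dZ t) (A t (- 1) Z dZ (2 * e)))).
  { intros Z dZ; unfold S, quot, A, c.
    vec; apply injective_projections; simpl; field; lra. }
  rewrite (HSA X dX), (HSA Y dY); apply graph_plus; apply GA; lra. }
apply (graph_lim (at_right 0) (S X) (S Y)); [|now apply HS|now apply HS].
exists (mkposreal (t / 2) ltac:(lra)); intros e He Hpos; apply HG.
apply ball_Rabs in He; simpl in He.
rewrite Rabs_pos_eq in He by lra; lra.
Qed.

End Graph.

(** * Laplace transforms *)

Instance infty_proper : ProperFilter (Rbar_locally p_infty) := Rbar_locally_filter p_infty.

Lemma cont_plus (x y : R -> V) : cont x -> cont y -> cont (fun t => plus (x t) (y t)).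
Proof. intros Hx Hy t; apply (continuous_plus (V := V)); auto. Qed.

Lemma cont_cmul (c : C) (x : R -> V) : cont x -> cont (fun t => cmul c (x t)).
Proof. intros Hx t; now apply continuous_cmul. Qed.

Lemma cont_minus (x y : R -> V) : cont x -> cont y -> cont (fun t => minus (x t) (y t)).
Proof. intros Hx Hy t; apply (continuous_minus (V := V)); auto. Qed.

Lemma cont_cexp_cmul (p : C) (x : R -> V) : cont x -> cont (fun t => cmul (cexp p t) (x t)).
Proof. intros Hx t; now apply continuous_cexp_cmul. Qed.

Lemma cont_const (v : V) : cont (fun _ => v).
Proof. intros t; apply continuous_const. Qed.

Lemma exp_small (b c eps : R) :
  0 < b -> 0 <= c -> 0 < eps -> exists T, 0 <= T /\ forall t, T <= t -> c * exp (- b * t) < eps.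
Proof.
intros Hb Hc He; exists (c / (eps * b)); split.
- apply Rdiv_le_0_compat; nra.
- intros t Ht.
  apply Rmult_le_compat_r with (r := eps * b) in Ht; [|nra].
  unfold Rdiv in Ht; rewrite Rmult_assoc, Rinv_l, Rmult_1_r in Ht by nra.
  replace (- b * t) with (- (b * t)) by ring; rewrite exp_Ropp.
  pose proof (exp_ineq1_le (b * t)) as Hexp.
  apply Rmult_lt_reg_r with (exp (b * t)); [apply exp_pos|].
  rewrite Rmult_assoc, Rinv_l, Rmult_1_r by (apply Rgt_not_eq, exp_pos).
  nra.
Qed.

Lemma growth_neg_lim (b : R) (x : R -> V) :
  b < 0 -> growth b x -> filterlim x (Rbar_locally p_infty) (locally (zero : V)).
Proof.
intros Hb [c [Hc Hx]]; apply filterlim_norm; [apply filter_filter|]; intros eps He.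
destruct (exp_small (- b) c eps) as [T [HT Hsmall]]; auto; [lra|].
exists T; intros t Ht.
eapply Rle_lt_trans; [right; exact (norm_minus_0 (x t))|].
eapply Rle_lt_trans; [apply Hx; lra|].
rewrite <- (Ropp_involutive b); apply Hsmall; lra.
Qed.

Lemma norm_RInt_decay (b c s t : R) (x : R -> V) :
  0 < b -> 0 <= c -> s <= t -> cont x ->
  (forall r, s <= r <= t -> norm (x r) <= c * exp (- b * r)) ->
  norm (RInt x s t) <= c / b * exp (- b * s).
Proof.
intros Hb Hc Hst Hx Hle.
eapply Rle_trans; [apply (norm_RInt_growth _ (- b) c); auto; lra|].
unfold Rdiv; rewrite Rmult_assoc; apply Rmult_le_compat_l; auto.
replace ((exp (- b * t) - exp (- b * s)) * / - b)
  with ((exp (- b * s) - exp (- b * t)) * / b) by (field; lra).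
rewrite (Rmult_comm (/ b)); apply Rmult_le_compat_r.
- left; now apply Rinv_0_lt_compat.
- pose proof (exp_pos (- b * t)); lra.
Qed.

Lemma prim_tail (b c s t : R) (x : R -> V) :
  0 < b -> 0 <= c -> 0 <= s <= t -> cont x ->
  (forall r, 0 <= r -> norm (x r) <= c * exp (- b * r)) ->
  norm (minus (prim x t) (prim x s)) <= c / b * exp (- b * s).
Proof.
intros Hb Hc Hst Hx Hle.
replace (minus (prim x t) (prim x s)) with (RInt x s t).
- apply (norm_RInt_decay b c s t); auto; [lra|]; intros r Hr; apply Hle; lra.
- unfold prim; rewrite <- (RInt_Chasles (V := V) x 0 s t) by (now apply cont_ex_RInt); vec.
Qed.

Lemma prim_lim_ex (b : R) (x : R -> V) :
  0 < b -> cont x -> growth (- b) x ->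
  exists X, filterlim (prim x) (Rbar_locally p_infty) (locally X).
Proof.
intros Hb Hx [c [Hc Hle]].
apply (Hierarchy.filterlim_locally_cauchy (U := V)); intros eps.
assert (Hcb : 0 <= c / b) by (apply Rdiv_le_0_compat; lra).
destruct (exp_small b (c / b) eps) as [T [HT Hsmall]]; auto; [apply cond_pos|].
exists (fun t => T < t); split; [now exists T|].
assert (Hwlog : forall s t, T < s -> s <= t -> norm (minus (prim x t) (prim x s)) < eps).
{ intros s t Hs Hst; eapply Rle_lt_trans; [apply (prim_tail b c s t x); auto; lra|].
  apply Hsmall; lra. }
intros s t Hs Ht; apply (norm_compat1 (V := V)).
destruct (Rle_dec s t) as [Hst|Hst]; [now apply Hwlog|].
eapply Rle_lt_trans; [right; exact (norm_minus_sym (prim x t) (prim x s))|].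
apply Hwlog; auto; lra.
Qed.

(** The integral is improper and need not converge absolutely: only the primitive
    of the solution is known to grow slowly. *)
Definition is_lap (x : R -> V) (p : C) (X : V) : Prop :=
  filterlim (prim (fun t => cmul (cexp (- p) t) (x t))) (Rbar_locally p_infty) (locally X).

Lemma is_lap_unique (x : R -> V) (p : C) (X Y : V) : is_lap x p X -> is_lap x p Y -> X = Y.
Proof. exact (filterlim_locally_unique (V := V) _ X Y). Qed.

Lemma is_lap_ext (x y : R -> V) (p : C) (X : V) :
  (forall t, 0 <= t -> x t = y t) -> is_lap x p X -> is_lap y p X.
Proof.
intros E; apply filterlim_ext_loc; exists 0; intros T HT.
apply prim_ext; [lra|]; intros s Hs; rewrite E; auto; lra.
Qed.

Lemma is_lap_plus (x y : R -> V) (p : C) (X Y : V) :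
  cont x -> cont y -> is_lap x p X -> is_lap y p Y ->
  is_lap (fun t => plus (x t) (y t)) p (plus X Y).
Proof.
intros Cx Cy Hx Hy.
eapply filterlim_ext; [|exact (lim_plus _ _ _ _ _ Hx Hy)].
intros T; simpl; rewrite <- prim_plus by now apply cont_cexp_cmul.
apply prim_ext_all; intros s; vec.
Qed.

Lemma is_lap_cmul (c : C) (x : R -> V) (p : C) (X : V) :
  cont x -> is_lap x p X -> is_lap (fun t => cmul c (x t)) p (cmul c X).
Proof.
intros Cx Hx.
eapply filterlim_ext; [|exact (lim_cmul _ _ _ _ _ (filterlim_const c) Hx)].
intros T; simpl; rewrite <- prim_cmul by now apply cont_cexp_cmul.
apply prim_ext_all; intros s; vec.
Qed.

Lemma is_lap_minus (x y : R -> V) (p : C) (X Y : V) :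
  cont x -> cont y -> is_lap x p X -> is_lap y p Y ->
  is_lap (fun t => minus (x t) (y t)) p (minus X Y).
Proof.
intros Cx Cy Hx Hy.
replace (minus X Y) with (plus X (cmul (- (1)) Y)) by vec.
apply is_lap_ext with (fun t => plus (x t) (cmul (- (1)) (y t))); [intros t _; vec|].
apply is_lap_plus; auto using cont_cmul; now apply is_lap_cmul.
Qed.

Lemma is_lap_shift (q : C) (x : R -> V) (p : C) (X : V) :
  is_lap x p X -> is_lap (fun t => cmul (cexp q t) (x t)) (p + q) X.
Proof.
apply filterlim_ext; intros T; apply prim_ext_all; intros s.
rewrite cmul_assoc, cexp_plus; do 2 f_equal; ring.
Qed.

Lemma is_lap_ex (beta : R) (x : R -> V) (p : C) :
  cont x -> growth beta x -> beta < Re p -> exists X, is_lap x p X.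
Proof.
intros Cx Hg Hp; apply (prim_lim_ex (Re p - beta)); [lra|now apply cont_cexp_cmul|].
replace (- (Re p - beta)) with (Re (- p) + beta) by (destruct p; simpl; ring).
now apply growth_cexp_cmul.
Qed.

Lemma is_lap_const (v : V) (p : C) : 0 < Re p -> is_lap (fun _ => v) p (cmul (/ p) v).
Proof.
intros Hp.
assert (Hp0 : p <> RtoC 0) by (intros ->; simpl in Hp; lra).
replace (cmul (/ p) v) with (minus (cmul (/ p) v) (cmul (/ p) zero)) by vec.
eapply filterlim_ext with (f := fun T => minus (cmul (/ p) v) (cmul (/ p) (cmul (cexp (- p) T) v))).
- intros T; rewrite (prim_unique _ (fun T => cmul (- / p) (cmul (cexp (- p) T) v))).
  + rewrite cexp_0_r; vec.
  + apply cont_cexp_cmul, cont_const.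
  + intros s; evar_last.
    * apply is_derive_cmul, is_derive_cexp_cmul, (is_derive_const (V := V)).
    * vec; field; auto.
- apply (lim_minus (Rbar_locally p_infty)); [apply filterlim_const|].
  apply (lim_cmul (Rbar_locally p_infty)); [apply filterlim_const|].
  apply (growth_neg_lim (Re (- p))); [destruct p; simpl in *; lra|].
  apply growth_cexp_const.
Qed.

(** Only the growth of the primitive matters: the transform of [x] exists, as an
    improper integral, wherever that of its primitive does. *)
Lemma is_lap_of_prim (beta : R) (x : R -> V) (p : C) (Y : V) :
  cont x -> growth beta (prim x) -> beta < Re p ->
  is_lap (prim x) p Y -> is_lap x p (cmul p Y).
Proof.
intros Cx Hg Hp HY.
replace (cmul p Y) with (minus zero (cmul (- p) Y)) by vec.
eapply filterlim_ext; [intros T; symmetry; exact (prim_cexp_parts _ _ _ Cx)|].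
apply (lim_minus (Rbar_locally p_infty)).
- apply (growth_neg_lim (Re (- p) + beta)); [destruct p; simpl in *; lra|].
  now apply growth_cexp_cmul.
- apply (lim_cmul (Rbar_locally p_infty)); [apply filterlim_const|exact HY].
Qed.

Lemma is_lap_prim (beta : R) (x : R -> V) (p : C) (X : V) :
  cont x -> growth beta (prim x) -> 0 <= beta -> beta < Re p ->
  is_lap x p X -> is_lap (prim x) p (cmul (/ p) X).
Proof.
intros Cx Hg Hb Hp HX.
destruct (is_lap_ex beta (prim x) p) as [Y HY]; auto using prim_cont.
assert (Hp0 : p <> RtoC 0) by (intros ->; simpl in Hp; lra).
replace (cmul (/ p) X) with Y; auto.
rewrite (is_lap_unique _ _ _ _ HX (is_lap_of_prim _ _ _ _ Cx Hg Hp HY)).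
vec; field; auto.
Qed.

Lemma graph_lap (L : operator H) (Llin : linear_op L) (Lclosed : closed_op L)
  (x y : R -> V) (p : C) (X Y : V) :
  cont x -> cont y -> (forall t, 0 <= t -> graph L (x t) (y t)) ->
  is_lap x p X -> is_lap y p Y -> graph L X Y.
Proof.
intros Cx Cy HG HX HY.
eapply (graph_lim L Lclosed (Rbar_locally p_infty)); [|exact HX|exact HY].
exists 0; intros T HT.
set (e := fun x t => cmul (cexp (- p) t) (x t)).
assert (Ce : forall x, cont x -> cont (e x)) by (intros z Cz; now apply cont_cexp_cmul).
replace (prim _ T) with (minus (prim (e x) T) (prim (e x) 0)) by (rewrite prim_0; unfold e; vec).
replace (prim (fun _ => cmul _ (y _)) T) with (minus (prim (e y) T) (prim (e y) 0))
  by (rewrite prim_0; unfold e; vec).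
apply (graph_increment L Llin Lclosed _ _ (e x) (e y)); [lra|].
intros s Hs; split; [|split].
- apply prim_derive, Ce, Cx.
- apply prim_derive, Ce, Cy.
- apply graph_cmul; auto; apply HG; lra.
Qed.

(** * The Fejer kernel *)

Definition cos_sum (n : nat) (th : R) : R := sum_f_R0 (fun a => cos (INR a * th)) n.
Definition sin_sum (n : nat) (th : R) : R := sum_f_R0 (fun a => sin (INR a * th)) n.

(** [n + 1] times the usual kernel, as the squared modulus of the sum of the
    powers [exp (i a th)], [a <= n]; this form shows that it is nonnegative. *)
Definition fejer (n : nat) (th : R) : R := (cos_sum n th) ^ 2 + (sin_sum n th) ^ 2.

Lemma fejer_pos (n : nat) (th : R) : 0 <= fejer n th.
Proof. unfold fejer; nra. Qed.

Lemma fejer_expand (n : nat) (th : R) :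
  fejer n th =
  sum_f_R0 (fun a => sum_f_R0 (fun b => cos ((INR a - INR b) * th)) n) n.
Proof.
assert (E : forall u v m,
  sum_f_R0 (fun a => cos (INR a * th) * u + sin (INR a * th) * v) m =
  cos_sum m th * u + sin_sum m th * v).
{ intros u v; unfold cos_sum, sin_sum; induction m as [|m IH]; [simpl; ring|].
  rewrite !tech5, IH; ring. }
transitivity (sum_f_R0 (fun a => cos (INR a * th) * cos_sum n th + sin (INR a * th) * sin_sum n th) n).
- rewrite E; unfold fejer; ring.
- apply sum_eq; intros a _.
  rewrite (Rmult_comm (cos (INR a * th))), (Rmult_comm (sin (INR a * th))), <- E.
  apply sum_eq; intros b _.
  rewrite Rmult_minus_distr_r, cos_minus; ring.
Qed.

(** Geometric summation. *)
Lemma fejer_le (n : nat) (th : R) : fejer n th * (2 - 2 * cos th) <= 4.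
Proof.
assert (E : forall m,
  cos_sum m th * (cos th - 1) - sin_sum m th * sin th = cos (INR (S m) * th) - 1 /\
  cos_sum m th * sin th + sin_sum m th * (cos th - 1) = sin (INR (S m) * th)).
{ unfold cos_sum, sin_sum; induction m as [|m [IH1 IH2]].
  - simpl; rewrite !Rmult_0_l, !Rmult_1_l, cos_0, sin_0; lra.
  - rewrite !tech5, (S_INR (S m)), (Rmult_plus_distr_r (INR (S m))), Rmult_1_l, cos_plus, sin_plus; lra. }
destruct (E n) as [E1 E2].
pose proof (sin2_cos2 th) as P; pose proof (sin2_cos2 (INR (S n) * th)) as P'.
pose proof (COS_bound (INR (S n) * th)) as [B _].
unfold Rsqr in P, P'; unfold fejer.
set (c := cos_sum n th) in *; set (s := sin_sum n th) in *.
assert ((c ^ 2 + s ^ 2) * (2 - 2 * cos th) = 2 - 2 * cos (INR (S n) * th)); [|lra].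
replace (2 - 2 * cos th) with ((cos th - 1) ^ 2 + sin th * sin th) by nra.
replace ((c ^ 2 + s ^ 2) * ((cos th - 1) ^ 2 + sin th * sin th)) with
  ((c * (cos th - 1) - s * sin th) ^ 2 + (c * sin th + s * (cos th - 1)) ^ 2) by ring.
rewrite E1, E2; nra.
Qed.

Lemma cos_ge_half (x : R) : Rabs x <= 1 -> / 2 <= cos x.
Proof.
intros Hx; pose proof PI2_3_2; pose proof (Rabs_pos x).
replace (/ 2) with (cos (PI / 3)) by (rewrite cos_PI3; field).
replace (cos x) with (cos (Rabs x)).
- apply cos_decr_1; lra.
- unfold Rabs; destruct (Rcase_abs x); [apply cos_neg|reflexivity].
Qed.

Lemma one_minus_cos_ge (x : R) : Rabs x <= 1 -> x ^ 2 / 4 <= 2 - 2 * cos x.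
Proof.
intros Hx.
assert (Hs : forall y, 0 < y <= 1 -> y / 2 <= sin y).
{ intros y Hy.
  destruct (MVT_cor2 sin cos 0 y ltac:(lra) (fun c _ => derivable_pt_lim_sin c)) as [c [E Hc]].
  rewrite sin_0 in E; pose proof (cos_ge_half c ltac:(rewrite Rabs_pos_eq; lra)); nra. }
replace (2 - 2 * cos x) with (4 * sin (x / 2) ^ 2).
- assert (Hle : Rabs (x / 4) <= Rabs (sin (x / 2))).
  { destruct (Rtotal_order x 0) as [Hn|[->|Hp]].
    - pose proof (Hs (- x / 2) ltac:(rewrite Rabs_left in Hx; lra)) as B.
      replace (- x / 2) with (- (x / 2)) in B by field; rewrite sin_neg in B.
      rewrite !Rabs_left; lra.
    - replace (0 / 4) with 0 by field; rewrite Rabs_R0; apply Rabs_pos.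
    - pose proof (Hs (x / 2) ltac:(rewrite Rabs_pos_eq in Hx; lra)) as B.
      rewrite !Rabs_pos_eq; lra. }
  apply pow_maj_Rabs with (n := 2%nat) in Hle.
  assert ((x / 4) ^ 2 <= sin (x / 2) ^ 2) by (rewrite <- (pow2_abs (sin _)); exact Hle).
  nra.
- replace x with (2 * (x / 2)) at 2 by field; rewrite cos_2a_sin; ring.
Qed.

Lemma fejer_far (n : nat) (th : R) : 0 < Rabs th <= 1 -> fejer n th <= 16 / th ^ 2.
Proof.
intros Hth.
pose proof (fejer_le n th) as H1; pose proof (one_minus_cos_ge th ltac:(lra)) as H2.
assert (Hp : 0 < th ^ 2) by (rewrite <- pow2_abs; nra).
apply Rmult_le_reg_r with (th ^ 2); auto.
unfold Rdiv; rewrite Rmult_assoc, Rinv_l by lra.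
pose proof (fejer_pos n th); nra.
Qed.

Lemma fejer_near (n : nat) (th : R) : INR n * Rabs th <= 1 -> INR n ^ 2 / 4 <= fejer n th.
Proof.
intros Hn.
assert (Hc : INR n / 2 <= cos_sum n th).
{ assert (E : forall m, (m <= n)%nat -> INR (S m) / 2 <= cos_sum m th).
  { induction m as [|m IH]; intros Hm; unfold cos_sum in *.
    - simpl; rewrite Rmult_0_l, cos_0; lra.
    - rewrite tech5, S_INR.
      pose proof (IH ltac:(lia)).
      pose proof (cos_ge_half (INR (S m) * th)) as B.
      rewrite Rabs_mult, (Rabs_pos_eq (INR (S m))) in B by apply pos_INR.
      apply le_INR in Hm; pose proof (Rabs_pos th).
      pose proof (B ltac:(nra)); lra. }
  pose proof (E n (le_n n)) as B; rewrite S_INR in B; lra. }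
unfold fejer; pose proof (pos_INR n); nra.
Qed.

Lemma continuous_fejer (n : nat) (d t s : R) : continuous (fun s => fejer n (d * (t - s))) s.
Proof.
assert (E : forall u, u = cos \/ u = sin -> forall m,
  ex_derive (fun s => sum_f_R0 (fun a => u (INR a * (d * (t - s)))) m) s).
{ intros u Hu; induction m as [|m IH]; simpl sum_f_R0.
  - destruct Hu as [-> | ->]; auto_derive; auto.
  - apply (ex_derive_plus (V := R_NormedModule)); auto.
    destruct Hu as [-> | ->]; auto_derive; auto. }
apply (ex_derive_continuous (V := R_NormedModule)); unfold fejer, cos_sum, sin_sum.
apply (ex_derive_plus (V := R_NormedModule)); apply ex_derive_pow; apply E; auto.
Qed.

(** Each term is compared with the increment of the primitive [atan (y / al) / al]
    over one step of the lattice, and these increments telescope; the mesh is at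
    most [al], so that the function varies by a bounded factor over a step. *)
Lemma lattice_sum_le (al d : R) (a n : nat) :
  0 < d <= al ->
  sum_f_R0 (fun b => / (al ^ 2 + ((INR a - INR b) * d) ^ 2)) n <= 3 * PI / (al * d).
Proof.
intros Hd.
set (T := fun y => atan (y / al)).
assert (HT : forall y, d / (al ^ 2 + y ^ 2) <= 3 / al * (al * (T (y + d) - T y)) / al).
{ intros y.
  destruct (MVT_cor2 T (fun z => / (1 + (z / al) ^ 2) * / al) y (y + d) ltac:(lra)) as [z [E Hz]].
  { intros z _; apply is_derive_Reals; unfold T; auto_derive; [auto|].
    replace (z * / al * (z * / al * 1)) with ((z / al) ^ 2) by (unfold Rdiv; ring); ring. }
  rewrite E.
  replace (3 / al * (al * (/ (1 + (z / al) ^ 2) * / al * (y + d - y))) / al)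
    with (3 * d / (al ^ 2 + z ^ 2)) by (field; split; nra).
  assert (0 < al ^ 2 + y ^ 2) by nra; assert (0 < al ^ 2 + z ^ 2) by nra.
  apply Rmult_le_reg_r with ((al ^ 2 + y ^ 2) * (al ^ 2 + z ^ 2)); [nra|].
  replace (d / (al ^ 2 + y ^ 2) * ((al ^ 2 + y ^ 2) * (al ^ 2 + z ^ 2)))
    with (d * (al ^ 2 + z ^ 2)) by (field; lra).
  replace (3 * d / (al ^ 2 + z ^ 2) * ((al ^ 2 + y ^ 2) * (al ^ 2 + z ^ 2)))
    with (d * (3 * (al ^ 2 + y ^ 2))) by (field; lra).
  apply Rmult_le_compat_l; [lra|].
  assert ((z - y) ^ 2 <= al ^ 2) by nra.
  nra. }
assert (HS : forall m, d * sum_f_R0 (fun b => / (al ^ 2 + ((INR a - INR b) * d) ^ 2)) m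
  <= 3 / al * (T ((INR a + 1) * d) - T ((INR a - INR m) * d))).
{ induction m as [|m IH].
  - simpl sum_f_R0; simpl INR; rewrite Rminus_0_r.
    pose proof (HT (INR a * d)) as B.
    replace (INR a * d + d) with ((INR a + 1) * d) in B by ring.
    replace (3 / al * (al * (T ((INR a + 1) * d) - T (INR a * d))) / al)
      with (3 / al * (T ((INR a + 1) * d) - T (INR a * d))) in B by (field; lra).
    exact B.
  - rewrite tech5, Rmult_plus_distr_l, S_INR.
    pose proof (HT ((INR a - (INR m + 1)) * d)) as B.
    replace ((INR a - (INR m + 1)) * d + d) with ((INR a - INR m) * d) in B by ring.
    set (T1 := T ((INR a - INR m) * d)) in *; set (T2 := T ((INR a - (INR m + 1)) * d)) in *.
    replace (3 / al * (al * (T1 - T2)) / al) with (3 / al * (T1 - T2)) in B by (field; lra).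
    unfold Rdiv at 1 in B; nra. }
apply Rmult_le_reg_l with d; [lra|].
eapply Rle_trans; [apply HS|].
replace (d * (3 * PI / (al * d))) with (3 / al * PI) by (field; lra).
apply Rmult_le_compat_l; [apply Rdiv_le_0_compat; lra|].
unfold T.
pose proof (atan_bound ((INR a + 1) * d / al)); pose proof (atan_bound ((INR a - INR n) * d / al)).
lra.
Qed.

(** * A pointwise bound by the Laplace transform on a vertical line *)

Lemma norm_lim_le {T : Type} (F : (T -> Prop) -> Prop) {FF : ProperFilter F}
  (x : T -> V) (l m : V) (tau : R) :
  filterlim x F (locally l) -> F (fun t => norm (minus (x t) m) <= tau) ->
  norm (minus l m) <= tau.
Proof.
intros Hx Hm; apply le_epsilon; intros eps He.
assert (FF' := filter_filter (F := F)).
destruct (filter_ex (F := F) _ (filter_and _ _ Hm (proj1 (filterlim_norm F x l) Hx eps He)))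
  as [t [H1 H2]].
replace (minus l m) with (minus (minus (x t) m) (minus (x t) l)) by vec.
eapply Rle_trans; [apply norm_minus_le|]; lra.
Qed.

Lemma prim_sum_le (g : R -> V) (k : nat -> R -> R) (B : nat -> R) (X : R) (n : nat) :
  cont g -> (forall a s, continuous (k a) s) ->
  (forall a, norm (prim (fun s => scal (k a s) (g s)) X) <= B a) ->
  norm (prim (fun s => scal (sum_f_R0 (fun a => k a s) n) (g s)) X) <= sum_f_R0 B n.
Proof.
intros Cg Ck Hle; induction n as [|n IH]; [apply Hle|].
assert (Cs : forall m s, continuous (fun s => sum_f_R0 (fun a => k a s) m) s).
{ induction m as [|m IHm]; intros s; [apply Ck|].
  apply (continuous_plus (V := R_NormedModule)); auto. }
rewrite tech5.
rewrite (prim_ext_all _ (fun s => plus (scal (sum_f_R0 (fun a => k a s) n) (g s)) (scal (k (S n) s) (g s))))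
  by (intros s; rewrite tech5; vec).
rewrite prim_plus by (intros s; apply (continuous_scal (V := V)); auto).
eapply Rle_trans; [apply norm_plus_le|]; specialize (Hle (S n)); lra.
Qed.

Lemma prim_cos_le (g : R -> V) (b c X y t e : R) (G G' : V) :
  0 < b -> 0 <= c -> 0 <= X -> cont g ->
  (forall r, 0 <= r -> norm (g r) <= c * exp (- b * r)) ->
  is_lap g (Ci * y) G -> norm G <= e ->
  is_lap g (Ci * RtoC (- y)) G' -> norm G' <= e ->
  norm (prim (fun s => scal (cos (y * (t - s))) (g s)) X) <= e + c / b * exp (- b * X).
Proof.
intros Hb Hc HX Cg Hg HG NG HG' NG'.
set (h := fun z s => cmul (cexp (- (Ci * RtoC z)) s) (g s)).
assert (Ch : forall z, cont (h z)) by (intros z; now apply cont_cexp_cmul).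
assert (Half : forall z Z, is_lap g (Ci * RtoC z) Z -> norm Z <= e ->
  norm (cmul (RtoC (/ 2) * cexp (Ci * RtoC z) t) (prim (h z) X)) <= (e + c / b * exp (- b * X)) / 2).
{ intros z Z HZ NZ.
  rewrite norm_cmul, Cmod_mult, Cmod_R, Cmod_cexp.
  replace (Re (Ci * RtoC z)) with 0 by (simpl; ring).
  rewrite Rmult_0_l, exp_0, Rmult_1_r, Rabs_pos_eq by lra.
  assert (norm (minus Z (prim (h z) X)) <= c / b * exp (- b * X)).
  { apply (norm_lim_le (Rbar_locally p_infty) (prim (h z))); auto.
    exists X; intros T HT; apply prim_tail; auto; [lra|].
    intros r Hr; unfold h; rewrite norm_cmul, Cmod_cexp.
    replace (Re (- (Ci * RtoC z))) with 0 by (simpl; ring).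
    rewrite Rmult_0_l, exp_0, Rmult_1_l; auto. }
  replace (prim (h z) X) with (minus Z (minus Z (prim (h z) X))) by vec.
  pose proof (norm_minus_le Z (minus Z (prim (h z) X))); lra. }
rewrite (prim_ext_all _ (fun s => plus
  (cmul (RtoC (/ 2) * cexp (Ci * RtoC y) t) (h y s))
  (cmul (RtoC (/ 2) * cexp (Ci * RtoC (- y)) t) (h (- y) s)))).
- rewrite prim_plus, !prim_cmul by auto using cont_cmul.
  eapply Rle_trans; [apply norm_plus_le|].
  pose proof (Half y G HG NG); pose proof (Half (- y) G' HG' NG'); lra.
- intros s; unfold h; vec.
  rewrite <- !RtoC_opp, <- !Cmult_assoc.
  replace (- (Ci * RtoC y))%C with (Ci * RtoC (- y))%C by (rewrite RtoC_opp; ring).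
  replace (- (Ci * RtoC (- y)))%C with (Ci * RtoC y)%C by (rewrite RtoC_opp; ring).
  rewrite !cexp_imaginary.
  replace (y * (t - s)) with (y * t - y * s) by ring; rewrite cos_minus.
  unfold cis; rewrite !Ropp_mult_distr_l_reverse, !cos_neg, !sin_neg.
  apply injective_projections; simpl; field.
Qed.

(** Replacing [g] by the constant [x] costs at most [eps] times the mass of the
    kernel, because the kernel is nonnegative. *)
Lemma norm_RInt_kernel_ge (g : R -> V) (F : R -> R) (u v eps : R) (x : V) :
  u <= v -> cont g -> (forall s, continuous F s) -> (forall s, 0 <= F s) ->
  (forall s, u <= s <= v -> norm (minus (g s) x) <= eps) ->
  (norm x - eps) * RInt F u v <= norm (RInt (fun s => scal (F s) (g s)) u v).
Proof.
intros Huv Cg CF PF Hg.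
assert (EF : ex_RInt F u v) by (apply (ex_RInt_continuous (V := R_CompleteNormedModule)); auto).
assert (HF : 0 <= RInt F u v) by (apply RInt_ge_0; auto).
assert (C1 : cont (fun s => scal (F s) (minus (g s) x))).
{ intros s; apply (continuous_scal (V := V)); auto; apply cont_minus; auto using cont_const. }
assert (C2 : cont (fun s => scal (F s) x)).
{ intros s; apply (continuous_scal (V := V)); auto; apply cont_const. }
assert (E1 : RInt (fun s => scal (F s) x) u v = scal (RInt F u v) x).
{ apply (is_RInt_unique (V := V)).
  replace (scal (RInt F u v) x) with (minus (scal (RInt F u v) x) (scal (RInt F u u) x))
    by (rewrite RInt_point; unfold zero; simpl; vec).
  apply (is_RInt_derive (V := V) (fun s => scal (RInt F u s) x)); intros s _; [|apply C2].
  apply (is_derive_scal_l (V := V)), (is_derive_RInt F _ u); [|apply CF].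
  apply filter_forall; intros r; apply (RInt_correct (V := R_CompleteNormedModule)).
  apply (ex_RInt_continuous (V := R_CompleteNormedModule)); auto. }
assert (N1 : norm (RInt (fun s => scal (F s) (minus (g s) x)) u v) <= eps * RInt F u v).
{ rewrite <- (RInt_scal (V := R_CompleteNormedModule)) by auto.
  apply norm_RInt_le_RInt; auto.
  - intros s; apply (continuous_scal_r (V := R_NormedModule)); auto.
  - intros s Hs; rewrite <- cmul_RtoC, norm_cmul, Cmod_R, Rabs_pos_eq by auto.
    rewrite Rmult_comm; apply Rmult_le_compat_r; auto. }
assert (E2 : RInt (fun s => scal (F s) (g s)) u v =
  plus (scal (RInt F u v) x) (RInt (fun s => scal (F s) (minus (g s) x)) u v)).
{ rewrite <- E1, <- (RInt_plus (V := V)) by now apply cont_ex_RInt.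
  apply (RInt_ext (V := V)); intros s _; vec. }
assert (N2 : norm x * RInt F u v = norm (scal (RInt F u v) x)).
{ rewrite <- cmul_RtoC, norm_cmul, Cmod_R, Rabs_pos_eq by auto; ring. }
rewrite Rmult_minus_distr_r, N2.
replace (scal (RInt F u v) x) with (minus (RInt (fun s => scal (F s) (g s)) u v)
  (RInt (fun s => scal (F s) (minus (g s) x)) u v)) by (rewrite E2; vec).
eapply Rle_trans; [apply Rplus_le_compat_r, norm_minus_le|]; lra.
Qed.

(** Comparing the integral of [g] against a Fejer kernel centred at [t] with its
    expansion into finitely many values of the transform recovers the size of
    [g t]. The window of length [n], the mesh [1/n] and the [n^2] frequencies are
    such that the kernel sees a single period and is concentrated at the scale
    [1/n], and that the truncation costs only a power of [n] times
    [exp (- b n)]. *)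
Lemma laplace_line_bound (g : R -> V) (b c A1 a1 A2 a2 t : R) :
  0 < b -> 0 <= c -> 0 <= A1 -> 0 < a1 -> 0 <= A2 -> 0 < a2 -> cont g ->
  (forall r, 0 <= r -> norm (g r) <= c * exp (- b * r)) ->
  (forall y : R, exists G, is_lap g (Ci * RtoC y) G /\
     norm G <= A1 * / (a1 ^ 2 + y ^ 2) + A2 * / (a2 ^ 2 + y ^ 2)) ->
  0 < t -> norm (g t) <= 12 * PI * (A1 / a1 + A2 / a2).
Proof.
intros Hb Hc HA1 Ha1 HA2 Ha2 Cg Hg HG Ht.
set (B := 3 * PI * (A1 / a1 + A2 / a2)).
replace (12 * PI * (A1 / a1 + A2 / a2)) with (4 * B) by (unfold B; ring).
assert (HB : 0 <= B).
{ pose proof PI_RGT_0; unfold B.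
  assert (0 <= A1 / a1) by (apply Rdiv_le_0_compat; lra).
  assert (0 <= A2 / a2) by (apply Rdiv_le_0_compat; lra). nra. }
apply le_epsilon; intros eps He.
assert (Hrho : exists rho, 0 < rho < t /\
  forall s, Rabs (s - t) <= rho -> norm (minus (g s) (g t)) <= eps).
{ destruct (proj1 (filterlim_norm (locally t) g (g t)) (Cg t) eps He) as [d Hd].
  exists (Rmin (d / 2) (t / 2)).
  pose proof (Rmin_l (d / 2) (t / 2)); pose proof (Rmin_r (d / 2) (t / 2)); pose proof (cond_pos d).
  split; [split; [apply Rmin_glb_lt; lra|lra]|].
  intros s Hs; left; apply Hd.
  change (Rabs (s - t) < d); lra. }
destruct Hrho as [rho [Hrho Hmod]].
(* error of the truncation, and contribution of the points at distance at least
   [rho] from [t] *)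
set (K := 32 * c / b ^ 3 + 64 * c / (b * rho ^ 2)).
assert (HK : 0 <= K).
{ unfold K; apply Rplus_le_le_0_compat; apply Rdiv_le_0_compat; try nra.
  - apply pow_lt; lra.
  - apply Rmult_lt_0_compat; nra. }
assert (Main : forall n : nat, 1 <= INR n -> t + rho <= INR n -> / INR n <= rho ->
  / INR n <= a1 -> / INR n <= a2 -> norm (g t) - eps <= 4 * B + K / INR n).
{ intros n Hn1 Hntr Hnr Hna1 Hna2.
  set (nu := INR n) in *.
  set (d := / nu) in *.
  assert (Hd : 0 < d) by (apply Rinv_0_lt_compat; lra).
  assert (Hdn : d * nu = 1) by (unfold d; field; lra).
  set (N := (n * n)%nat).
  assert (HN : INR N = nu ^ 2) by (unfold N; rewrite mult_INR; unfold nu; ring).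
  set (F := fun s => fejer N (d * (t - s))).
  assert (CF : forall s, continuous F s) by (intros s; apply continuous_fejer).
  assert (PF : forall s, 0 <= F s) by (intros s; apply fejer_pos).
  assert (CFg : cont (fun s => scal (F s) (g s))).
  { intros s; apply (continuous_scal (V := V)); auto. }
  set (tau := c / b * exp (- b * nu)).
  assert (Hcb : 0 <= c / b) by (apply Rdiv_le_0_compat; lra).
  (* the kernel is a trigonometric sum, so that its integral against [g] is a sum
     of values of the transform, up to the truncation of the window *)
  assert (Up : norm (prim (fun s => scal (F s) (g s)) nu) <= (nu ^ 2 + 1) * (B * nu + (nu ^ 2 + 1) * tau)).
  { set (E := fun y => A1 * / (a1 ^ 2 + y ^ 2) + A2 * / (a2 ^ 2 + y ^ 2)).
    set (k := fun a b' s => cos ((INR a - INR b') * d * (t - s))).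
    assert (Ck : forall a b' s, continuous (k a b') s).
    { intros a b' s; apply (ex_derive_continuous (V := R_NormedModule)); unfold k; auto_derive; auto. }
    assert (Cks : forall a m s, continuous (fun s => sum_f_R0 (fun b' => k a b' s) m) s).
    { induction m as [|m IHm]; intros s; [apply Ck|].
      apply (continuous_plus (V := R_NormedModule)); [apply IHm|apply Ck]. }
    rewrite (prim_ext_all _ (fun s => scal (sum_f_R0 (fun a => sum_f_R0 (fun b' => k a b' s) N) N) (g s))).
    2:{ intros s; unfold F; rewrite fejer_expand; apply (f_equal (fun z => scal z (g s))).
        apply sum_eq; intros a _; apply sum_eq; intros b' _; unfold k; f_equal; ring. }
    eapply Rle_trans.
    - apply (prim_sum_le g (fun a s => sum_f_R0 (fun b' => k a b' s) N)
        (fun a => sum_f_R0 (fun b' => E ((INR a - INR b') * d) + tau) N)); auto.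
      intros a; apply (prim_sum_le g (k a)); auto.
      intros b'; set (y := (INR a - INR b') * d).
      destruct (HG y) as [G [HGy NG]]; destruct (HG (- y)) as [G' [HGy' NG']].
      apply (prim_cos_le g b c nu y t (E y) G G'); auto; [lra|].
      unfold E; replace (y ^ 2) with ((- y) ^ 2) by ring; exact NG'.
    - assert (Hrow : forall a, sum_f_R0 (fun b' => E ((INR a - INR b') * d) + tau) N
        <= B * nu + (nu ^ 2 + 1) * tau).
      { intros a; rewrite sum_plus, sum_cte, S_INR, HN.
        assert (Out : forall x h, sum_f_R0 (fun b' => x * h b') N = x * sum_f_R0 h N).
        { intros x h; rewrite scal_sum; apply sum_eq; intros; ring. }
        unfold E; rewrite sum_plus, !Out.
        pose proof (lattice_sum_le a1 d a N ltac:(lra)) as L1.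
        pose proof (lattice_sum_le a2 d a N ltac:(lra)) as L2.
        apply Rmult_le_compat_l with (r := A1) in L1; auto.
        apply Rmult_le_compat_l with (r := A2) in L2; auto.
        replace (B * nu) with (A1 * (3 * PI / (a1 * d)) + A2 * (3 * PI / (a2 * d)))
          by (unfold B, d; field; lra).
        lra. }
      eapply Rle_trans; [apply sum_Rle; intros a _; apply Hrow|].
      rewrite sum_cte, S_INR, HN; lra. }
  assert (Far : forall u v, 0 <= u <= v -> (forall s, u <= s <= v -> rho <= Rabs (s - t) <= nu) ->
    norm (RInt (fun s => scal (F s) (g s)) u v) <= 16 * nu ^ 2 / rho ^ 2 * (c / b)).
  { intros u v Huv Hfar.
    assert (HC : 0 <= 16 * nu ^ 2 / rho ^ 2) by (apply Rdiv_le_0_compat; nra).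
    eapply Rle_trans.
    - apply (norm_RInt_decay b (16 * nu ^ 2 / rho ^ 2 * c)); auto; [nra|lra|].
      intros s Hs; rewrite <- cmul_RtoC, norm_cmul, Cmod_R, Rabs_pos_eq by auto.
      rewrite Rmult_assoc; apply Rmult_le_compat; [auto|apply norm_ge_0| |apply Hg; lra].
      specialize (Hfar s Hs).
      assert (Habs : Rabs (d * (t - s)) = d * Rabs (s - t)).
      { rewrite Rabs_mult, (Rabs_pos_eq d), Rabs_minus_sym by lra; reflexivity. }
      eapply Rle_trans; [apply fejer_far; rewrite Habs; nra|].
      rewrite <- pow2_abs, Habs.
      replace (16 * nu ^ 2 / rho ^ 2) with (16 / (d * rho) ^ 2) by (unfold d; field; lra).
      apply Rmult_le_compat_l; [lra|]; apply Rinv_le_contravar.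
      + apply pow_lt; nra.
      + apply pow_incr; nra.
    - unfold Rdiv at 1; rewrite !Rmult_assoc; apply Rmult_le_compat_l; auto.
      rewrite <- Rmult_assoc, <- (Rmult_1_r (c / b)); apply Rmult_le_compat_l; auto.
      rewrite <- exp_0; apply Rnot_lt_le; intros Hlt; apply exp_lt_inv in Hlt; nra. }
  (* all frequencies are in phase within [d] of [t]: this suffices for the mass *)
  assert (Mass : nu ^ 3 / 2 <= RInt F (t - rho) (t + rho)).
  { assert (EF : forall u v, ex_RInt F u v).
    { intros u v; apply (ex_RInt_continuous (V := R_CompleteNormedModule)); auto. }
    assert (P1 : 0 <= RInt F (t - rho) (t - d)) by (apply RInt_ge_0; auto; lra).
    assert (P3 : 0 <= RInt F (t + d) (t + rho)) by (apply RInt_ge_0; auto; lra).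
    assert (P2 : nu ^ 3 / 2 <= RInt F (t - d) (t + d)).
    { replace (nu ^ 3 / 2) with (RInt (fun _ => (nu ^ 2) ^ 2 / 4) (t - d) (t + d))
        by (rewrite RInt_const; unfold scal; simpl; unfold mult; simpl; unfold d; field; lra).
      apply RInt_le; auto; [lra|apply ex_RInt_const|].
      intros s Hs; unfold F; rewrite <- HN; apply fejer_near.
      rewrite HN, Rabs_mult, (Rabs_pos_eq d) by lra.
      assert (Rabs (t - s) <= d) by (apply Rabs_le; lra).
      replace 1 with (nu ^ 2 * (d * d)) by (unfold d; field; lra).
      apply Rmult_le_compat_l; [nra|]; apply Rmult_le_compat_l; lra. }
    rewrite <- (RInt_Chasles (V := R_CompleteNormedModule) F (t - rho) (t - d) (t + rho)) by auto.
    rewrite <- (RInt_Chasles (V := R_CompleteNormedModule) F (t - d) (t + d) (t + rho)) by auto.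
    unfold plus; simpl; lra. }
  assert (Near := norm_RInt_kernel_ge g F (t - rho) (t + rho) eps (g t) ltac:(lra) Cg CF PF
    ltac:(intros s Hs; apply Hmod, Rabs_le; lra)).
  assert (Split : RInt (fun s => scal (F s) (g s)) (t - rho) (t + rho) =
    minus (minus (prim (fun s => scal (F s) (g s)) nu) (RInt (fun s => scal (F s) (g s)) 0 (t - rho)))
      (RInt (fun s => scal (F s) (g s)) (t + rho) nu)).
  { unfold prim.
    rewrite <- (RInt_Chasles (V := V) _ 0 (t - rho) nu) by now apply cont_ex_RInt.
    rewrite <- (RInt_Chasles (V := V) _ (t - rho) (t + rho) nu) by now apply cont_ex_RInt.
    vec. }
  pose proof (Far 0 (t - rho) ltac:(lra) ltac:(intros s Hs; rewrite Rabs_left; lra)) as F1.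
  pose proof (Far (t + rho) nu ltac:(lra) ltac:(intros s Hs; rewrite Rabs_pos_eq; lra)) as F2.
  rewrite Split in Near.
  pose proof (norm_minus_le (minus (prim (fun s => scal (F s) (g s)) nu) (RInt (fun s => scal (F s) (g s)) 0 (t - rho)))
      (RInt (fun s => scal (F s) (g s)) (t + rho) nu)) as T1.
  pose proof (norm_minus_le (prim (fun s => scal (F s) (g s)) nu) (RInt (fun s => scal (F s) (g s)) 0 (t - rho))) as T2.
  destruct (Rle_lt_dec (norm (g t) - eps) 0) as [Hneg|Hpos].
  { assert (0 <= K / nu) by (apply Rdiv_le_0_compat; lra). lra. }
  apply Rmult_le_compat_l with (r := norm (g t) - eps) in Mass; [|lra].
  assert (Tau : nu ^ 2 * tau <= 4 * c / b ^ 3).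
  { unfold tau; replace (- b * nu) with (- (b * nu)) by ring; rewrite exp_Ropp.
    pose proof (exp_ineq1_le (b * nu / 2)) as H1.
    assert (H2 : exp (b * nu) = exp (b * nu / 2) ^ 2)
      by (replace (b * nu) with (b * nu / 2 + b * nu / 2) at 1 by field; rewrite exp_plus; ring).
    assert (H0 : 0 <= b * nu) by nra.
    assert (H3 : (b * nu) ^ 2 / 4 <= exp (b * nu)).
    { rewrite H2; replace ((b * nu) ^ 2 / 4) with ((b * nu / 2) ^ 2) by field.
      apply pow_incr; lra. }
    apply Rmult_le_reg_r with (exp (b * nu)); [apply exp_pos|].
    replace (nu ^ 2 * (c / b * / exp (b * nu)) * exp (b * nu)) with (4 * c / b ^ 3 * ((b * nu) ^ 2 / 4))
      by (field; split; [apply Rgt_not_eq, exp_pos|lra]).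
    apply Rmult_le_compat_l; auto.
    apply Rdiv_le_0_compat; [lra|apply pow_lt; lra]. }
  assert (Htau : 0 <= tau) by (apply Rmult_le_pos; auto; left; apply exp_pos).
  assert (Up' : (nu ^ 2 + 1) * (B * nu + (nu ^ 2 + 1) * tau) <= 2 * nu ^ 2 * (B * nu + 2 * (4 * c / b ^ 3))).
  { assert (Hnu2 : 1 <= nu ^ 2) by nra.
    assert (Hsq : (nu ^ 2 + 1) * tau <= 2 * (nu ^ 2 * tau)).
    { replace (2 * (nu ^ 2 * tau)) with ((2 * nu ^ 2) * tau) by ring.
      apply Rmult_le_compat_r; lra. }
    assert (0 <= B * nu) by (apply Rmult_le_pos; lra).
    assert (0 <= (nu ^ 2 + 1) * tau) by (apply Rmult_le_pos; lra).
    apply Rmult_le_compat; lra. }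
  assert (Fin : (norm (g t) - eps) * (nu ^ 3 / 2) <=
    2 * nu ^ 2 * (B * nu + 2 * (4 * c / b ^ 3)) + 2 * (16 * nu ^ 2 / rho ^ 2 * (c / b))) by lra.
  apply Rmult_le_reg_r with (nu ^ 3 / 2); [assert (0 < nu ^ 3) by (apply pow_lt; lra); lra|].
  eapply Rle_trans; [exact Fin|]; right; unfold K, d; field; lra. }
assert (norm (g t) - eps <= 4 * B); [|lra].
apply le_epsilon; intros e2 He2.
destruct (INR_unbounded (1 + (t + rho) + / rho + / a1 + / a2 + K / e2)) as [n Hn].
assert (0 < / rho) by (apply Rinv_0_lt_compat; lra).
assert (0 < / a1) by (apply Rinv_0_lt_compat; lra).
assert (0 < / a2) by (apply Rinv_0_lt_compat; lra).
assert (0 <= K / e2) by (apply Rdiv_le_0_compat; lra).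
assert (Inv : forall z, 0 < z -> / z <= INR n -> / INR n <= z).
{ intros z Hz Hle; rewrite <- (Rinv_inv z); apply Rinv_le_contravar; auto.
  now apply Rinv_0_lt_compat. }
eapply Rle_trans; [apply (Main n); try (apply Inv); lra|].
apply Rplus_le_compat_l.
apply Rmult_le_reg_r with (INR n); [lra|].
unfold Rdiv; rewrite Rmult_assoc, Rinv_l, Rmult_1_r by lra.
replace K with (e2 * (K / e2)) at 1 by (field; lra).
apply Rmult_le_compat_l; lra.
Qed.

(** * Uniqueness and the Tauberian theorem *)

Lemma decay_of_growth (a sigma : R) (x : R -> V) :
  growth a x -> exists c, 0 <= c /\ forall r, 0 <= r ->
    norm (cmul (cexp (RtoC (- sigma)) r) (x r)) <= c * exp (- (sigma - a) * r).
Proof.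
intros Hx; destruct (growth_cexp_cmul a (RtoC (- sigma)) x Hx) as [c [Hc Hle]].
exists c; split; auto; intros r Hr.
replace (- (sigma - a)) with (Re (RtoC (- sigma)) + a) by (simpl; ring); auto.
Qed.

Lemma is_lap_line (x : R -> V) (sigma y : R) (X : V) :
  is_lap x (RtoC sigma + Ci * RtoC y) X ->
  is_lap (fun t => cmul (cexp (RtoC (- sigma)) t) (x t)) (Ci * RtoC y) X.
Proof.
intros HX.
replace (Ci * RtoC y)%C with (RtoC sigma + Ci * RtoC y + RtoC (- sigma))%C
  by (rewrite RtoC_opp; ring).
now apply is_lap_shift.
Qed.

(** The bound above, for a transform that vanishes on the line. *)
Lemma is_lap_zero (x : R -> V) (a sigma t : R) :
  cont x -> growth a x -> a < sigma ->
  (forall y, is_lap x (RtoC sigma + Ci * RtoC y) zero) -> 0 < t -> x t = zero.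
Proof.
intros Cx Gx Hs HX Ht.
destruct (decay_of_growth a sigma x Gx) as [c [Hc Hle]].
assert (B := laplace_line_bound _ (sigma - a) c 0 1 0 1 t ltac:(lra) Hc ltac:(lra) ltac:(lra)
  ltac:(lra) ltac:(lra) (cont_cexp_cmul (RtoC (- sigma)) x Cx) Hle).
assert (N : norm (cmul (cexp (RtoC (- sigma)) t) (x t)) <= 0).
{ replace 0 with (12 * PI * (0 / 1 + 0 / 1)) by field; apply B; auto.
  intros y; exists zero; split; [apply is_lap_line, HX|].
  right; rewrite !Rmult_0_l, Rplus_0_r; apply norm_0. }
rewrite norm_cmul, Cmod_cexp in N.
pose proof (exp_pos (Re (RtoC (- sigma)) * t)); pose proof (norm_ge_0 (V := V) (x t)) as P.
apply (norm_eq_zero (V := V)); apply Rle_antisym; auto.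
apply Rmult_le_reg_l with (exp (Re (RtoC (- sigma)) * t)); auto; rewrite Rmult_0_r; exact N.
Qed.

Lemma Cmod_sqr (p : C) : Cmod p ^ 2 = Re p ^ 2 + Im p ^ 2.
Proof. unfold Cmod; rewrite pow2_sqrt; [reflexivity|]; destruct p; simpl; nra. Qed.

Definition cesaro_lim (x : R -> V) (v : V) : Prop :=
  filterlim (fun t => scal (/ t) (prim (prim x) t)) (Rbar_locally p_infty) (locally v).

Lemma growth_const (beta : R) (v : V) : 0 <= beta -> growth beta (fun _ => v).
Proof.
intros Hb; exists (norm v); split; [apply norm_ge_0|]; intros t Ht.
pose proof (norm_ge_0 (V := V) v) as P.
pose proof (exp_ineq1_le (beta * t)) as E.
rewrite <- (Rmult_1_r (norm v)) at 1; apply Rmult_le_compat_l; auto; nra.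
Qed.

(** The double primitive of [h], less [t Phi0], has the transform
    [(Phi p - Phi0) / p^2]. On the line [Re p = 1/t] this is small compared with
    [1 / |p|^2] near the origin and of the order of [1 / |p|^2] away from it, and
    the integrals of these two bounds are [o(t)] and [O(1)]. *)
Lemma cesaro_of_laplace (h : R -> V) (Phi : C -> V) (Phi0 : V) (s0 M : R) :
  cont h -> (forall eps, 0 < eps -> growth eps (prim h)) -> 0 < s0 -> 0 <= M ->
  (forall p, 0 < Re p < s0 -> is_lap h p (Phi p)) ->
  (forall p, 0 < Re p < s0 -> norm (Phi p) <= M) ->
  (forall eps, 0 < eps -> exists delta, 0 < delta /\
     forall p, 0 < Re p -> Cmod p < delta -> norm (minus (Phi p) Phi0) <= eps) ->
  cesaro_lim h Phi0.
Proof.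
intros Ch Gh Hs0 HM HPhi BPhi LPhi.
apply filterlim_norm; [apply filter_filter|]; intros eps He.
(* [144] bounds the constant [12 * PI * exp 1] of the line estimate *)
set (eta := eps / 288).
assert (Heta : 0 < eta) by (unfold eta; lra).
destruct (LPhi eta Heta) as [delta [Hdelta Hsmall]].
set (Q := 2 * (M + norm Phi0)).
assert (HQ : 0 <= Q) by (unfold Q; pose proof (norm_ge_0 (V := V) Phi0); lra).
exists (1 + / s0 + 288 * Q / (delta * eps)); intros t Ht.
assert (0 < / s0) by now apply Rinv_0_lt_compat.
assert (0 <= 288 * Q / (delta * eps)) by (apply Rdiv_le_0_compat; nra).
assert (Ht0 : 0 < t) by lra.
set (sigma := / t).
assert (Hsig : 0 < sigma) by now apply Rinv_0_lt_compat.
assert (Hsig0 : sigma < s0).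
{ unfold sigma; rewrite <- (Rinv_inv s0); apply Rinv_lt_contravar; [|lra].
  apply Rmult_lt_0_compat; lra. }
set (r := fun s => minus (prim (prim h) s) (prim (fun _ => Phi0) s)).
assert (Cr : cont r) by (apply cont_minus; auto using prim_cont, cont_const).
assert (Gr : growth (sigma / 2) r).
{ apply growth_ext with (fun s => plus (prim (prim h) s) (cmul (- (1)) (prim (fun _ => Phi0) s))).
  - intros s _; unfold r; vec.
  - apply growth_plus; [|apply growth_cmul]; apply growth_prim;
      auto using prim_cont, cont_const; try lra.
    + apply Gh; lra.
    + apply growth_const; lra. }
assert (Lr : forall p, Re p = sigma -> is_lap r p (cmul (/ p) (cmul (/ p) (minus (Phi p) Phi0)))).
{ intros p Hp.
  replace (cmul (/ p) (cmul (/ p) (minus (Phi p) Phi0))) with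
    (minus (cmul (/ p) (cmul (/ p) (Phi p))) (cmul (/ p) (cmul (/ p) Phi0))) by vec.
  apply is_lap_minus; auto using prim_cont, cont_const.
  - apply (is_lap_prim (sigma / 2)); auto using prim_cont; try lra.
    + apply growth_prim; auto using prim_cont; [lra|apply Gh; lra].
    + apply (is_lap_prim (sigma / 2)); auto; try lra; [apply Gh; lra|apply HPhi; lra].
  - apply (is_lap_prim (sigma / 2)); auto using cont_const; try lra.
    + apply growth_prim; auto using cont_const; [lra|apply growth_const; lra].
    + apply is_lap_const; lra. }
destruct (decay_of_growth (sigma / 2) sigma r Gr) as [c [Hc Hle]].
assert (B := laplace_line_bound _ (sigma - sigma / 2) c eta sigma Q delta t ltac:(lra) Hc
  ltac:(lra) Hsig HQ Hdelta (cont_cexp_cmul (RtoC (- sigma)) r Cr) Hle).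
assert (Hline : forall y : R, exists G : V,
  is_lap (fun s => cmul (cexp (RtoC (- sigma)) s) (r s)) (Ci * RtoC y) G /\
  norm G <= eta * / (sigma ^ 2 + y ^ 2) + Q * / (delta ^ 2 + y ^ 2)).
{ intros y; set (p := (RtoC sigma + Ci * RtoC y)%C).
  assert (Rp : Re p = sigma) by (unfold p; simpl; ring).
  assert (Ip : Im p = y) by (unfold p; simpl; ring).
  assert (Pp : p <> RtoC 0) by (intros E; rewrite E in Rp; simpl in Rp; lra).
  exists (cmul (/ p) (cmul (/ p) (minus (Phi p) Phi0))); split; [apply is_lap_line, Lr, Rp|].
  rewrite !norm_cmul, !Cmod_inv by auto.
  assert (Mp : 0 < Cmod p) by now apply Cmod_gt_0.
  assert (Sp : Cmod p ^ 2 = sigma ^ 2 + y ^ 2) by (rewrite Cmod_sqr, Rp, Ip; reflexivity).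
  rewrite <- Rmult_assoc, <- Rinv_mult.
  replace (Cmod p * Cmod p) with (sigma ^ 2 + y ^ 2) by (rewrite <- Sp; ring).
  assert (P1 : 0 < sigma ^ 2 + y ^ 2) by nra; assert (P2 : 0 < delta ^ 2 + y ^ 2) by nra.
  assert (I1 : 0 < / (sigma ^ 2 + y ^ 2)) by now apply Rinv_0_lt_compat.
  assert (I2 : 0 < / (delta ^ 2 + y ^ 2)) by now apply Rinv_0_lt_compat.
  rewrite (Rmult_comm (/ _)).
  destruct (Rlt_le_dec (Cmod p) delta) as [Hlt|Hge].
  - pose proof (Hsmall p ltac:(lra) Hlt) as S.
    apply Rmult_le_compat_r with (r := / (sigma ^ 2 + y ^ 2)) in S; [|lra].
    assert (0 <= Q * / (delta ^ 2 + y ^ 2)) by (apply Rmult_le_pos; lra).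
    eapply Rle_trans; [exact S|lra].
  - pose proof (norm_minus_le (Phi p) Phi0) as T; pose proof (BPhi p ltac:(lra)) as T'.
    assert (I3 : / (sigma ^ 2 + y ^ 2) <= 2 * / (delta ^ 2 + y ^ 2)).
    { apply Rmult_le_reg_r with ((sigma ^ 2 + y ^ 2) * (delta ^ 2 + y ^ 2)); [nra|].
      field_simplify; try lra.
      assert (delta ^ 2 <= Cmod p ^ 2) by (apply pow_incr; lra). nra. }
    assert (norm (minus (Phi p) Phi0) * / (sigma ^ 2 + y ^ 2) <= (Q / 2) * (2 * / (delta ^ 2 + y ^ 2))).
    { apply Rmult_le_compat; [apply norm_ge_0|lra|unfold Q; lra|lra]. }
    assert (0 <= eta * / (sigma ^ 2 + y ^ 2)) by (apply Rmult_le_pos; lra).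
    eapply Rle_trans; [eassumption|lra]. }
specialize (B Hline Ht0); cbv beta in B.
rewrite norm_cmul, Cmod_cexp in B.
replace (Re (RtoC (- sigma)) * t) with (- (1)) in B by (simpl; unfold sigma; field; lra).
assert (Er : minus (scal (/ t) (prim (prim h) t)) Phi0 = cmul (RtoC sigma) (r t)).
{ assert (Et : prim (fun _ => Phi0) t = cmul (RtoC t) Phi0).
  { unfold prim; rewrite (RInt_const (V := V)), Rminus_0_r; reflexivity. }
  unfold r, sigma; rewrite Et; vec; rewrite RtoC_inv by lra; field.
  intros E; apply RtoC_inj in E; lra. }
eapply Rle_lt_trans; [right; exact (f_equal norm Er)|].
rewrite norm_cmul, Cmod_R, Rabs_pos_eq by lra.
rewrite exp_Ropp in B.
assert (E1 : 0 < exp 1 <= 3) by (split; [apply exp_pos|apply exp_le_3]).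
assert (Bound : norm (r t) <= 144 * (eta * t + Q / delta)).
{ assert (S : 0 <= eta * t + Q / delta).
  { apply Rplus_le_le_0_compat; [nra|apply Rdiv_le_0_compat; lra]. }
  replace (eta / sigma) with (eta * t) in B by (unfold sigma; field; lra).
  pose proof PI_4; pose proof PI_RGT_0.
  apply Rmult_le_compat_l with (r := exp 1) in B; [|lra].
  rewrite <- Rmult_assoc, Rinv_r, Rmult_1_l in B by lra.
  eapply Rle_trans; [exact B|].
  apply Rle_trans with (3 * (12 * 4 * (eta * t + Q / delta))); [|lra].
  apply Rmult_le_compat; [lra| |lra|apply Rmult_le_compat_r; lra].
  apply Rmult_le_pos; lra. }
apply Rle_lt_trans with (sigma * (144 * (eta * t + Q / delta))).
{ apply Rmult_le_compat_l; lra. }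
replace (sigma * (144 * (eta * t + Q / delta))) with (eps / 2 + 144 * Q / delta * sigma)
  by (unfold eta, sigma; field; lra).
assert (144 * Q / delta * sigma < eps / 2); [|lra].
apply Rmult_lt_reg_r with (2 * t / eps); [apply Rdiv_lt_0_compat; lra|].
replace (144 * Q / delta * sigma * (2 * t / eps)) with (288 * Q / (delta * eps))
  by (unfold sigma; field; lra).
replace (eps / 2 * (2 * t / eps)) with t by (field; lra).
lra.
Qed.

(** * Solutions of the evolution equation *)

(** Solutions are given on the half-line; they are continued by their initial
    value to have curves that are continuous everywhere. *)
Definition clamp (u : R -> V) (t : R) : V := u (Rmax 0 t).

Lemma clamp_pos (u : R -> V) (t : R) : 0 <= t -> clamp u t = u t.
Proof. intros Ht; unfold clamp; now rewrite Rmax_right. Qed.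

Lemma right_quotient (x : R -> V) (l : V) :
  is_derive x 0 l ->
  filterlim (fun e => scal (/ e) (minus (x e) (x 0))) (at_right 0) (locally l).
Proof.
intros Hx; apply filterlim_norm; [apply filter_filter|]; intros eps He.
destruct (is_derive_norm x 0 l (eps / 2) Hx ltac:(lra)) as [d [Hd B]].
exists (mkposreal d Hd); intros e Hb Hpos.
apply ball_Rabs in Hb; simpl in Hb.
specialize (B e Hb); rewrite Rminus_0_r, (Rabs_pos_eq e) in B by lra.
assert (E : minus (scal (/ e) (minus (x e) (x 0))) l =
  cmul (RtoC (/ e)) (minus (minus (x e) (x 0)) (scal e l))).
{ vec; rewrite RtoC_inv by lra; field; intros E; apply RtoC_inj in E; lra. }
eapply Rle_lt_trans; [right; exact (f_equal norm E)|].
assert (0 < / e) by now apply Rinv_0_lt_compat.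
rewrite norm_cmul, Cmod_R, Rabs_pos_eq by lra.
apply Rmult_le_compat_l with (r := / e) in B; [|lra].
replace (/ e * (eps / 2 * e)) with (eps / 2) in B by (field; lra); lra.
Qed.

Lemma right_quotient_prim (x : R -> V) :
  cont x ->
  filterlim (fun e => scal (/ e) (minus (prim (prim x) e) (prim (prim x) 0)))
    (at_right 0) (locally (zero : V)).
Proof.
intros Cx; rewrite <- (prim_0 x); apply right_quotient, prim_derive, prim_cont, Cx.
Qed.

Lemma clamp_cont (u : R -> V) (u1 : V) :
  (forall t, 0 < t -> continuous u t) ->
  filterlim (fun e => scal (/ e) (minus (u e) (u 0))) (at_right 0) (locally u1) ->
  cont (clamp u).
Proof.
intros Cu Hu t.
destruct (Rtotal_order t 0) as [Hn|[->|Hp]].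
- apply continuous_ext_loc with (fun _ => u 0); [|apply continuous_const].
  exists (mkposreal (- t) ltac:(lra)); intros s Hs; unfold clamp.
  apply ball_Rabs in Hs; simpl in Hs.
  apply Rabs_lt_between in Hs; rewrite Rmax_left by lra; reflexivity.
- apply filterlim_norm; [apply filter_filter|]; intros eps He.
  destruct (proj1 (filterlim_norm _ _ _) Hu 1 Rlt_0_1) as [d Hd].
  pose proof (norm_ge_0 (V := V) u1) as P; pose proof (cond_pos d) as Pd.
  assert (He' : 0 < Rmin d (eps / (2 + norm u1))).
  { apply Rmin_glb_lt; auto; apply Rdiv_lt_0_compat; lra. }
  exists (mkposreal _ He'); intros s Hs.
  apply ball_Rabs in Hs; simpl in Hs.
  destruct (Rle_lt_dec s 0) as [Hs0|Hs0].
  + unfold clamp; rewrite !Rmax_left by lra.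
    eapply Rle_lt_trans; [right|exact He].
    transitivity (norm (zero : V)); [f_equal; vec|apply norm_0].
  + rewrite Rminus_0_r, Rabs_pos_eq in Hs by lra.
    pose proof (Rmin_l d (eps / (2 + norm u1))); pose proof (Rmin_r d (eps / (2 + norm u1))).
    rewrite !clamp_pos by lra.
    set (q := scal (/ s) (minus (u s) (u 0))).
    assert (Nq : norm (minus q u1) < 1).
    { apply Hd; auto; change (Rabs (s - 0) < d).
      rewrite Rminus_0_r, Rabs_pos_eq; lra. }
    assert (E : minus (u s) (u 0) = cmul (RtoC s) (plus (minus q u1) u1)).
    { unfold q; vec; rewrite RtoC_inv by lra; field; intros E; apply RtoC_inj in E; lra. }
    eapply Rle_lt_trans; [right; exact (f_equal norm E)|].
    rewrite norm_cmul, Cmod_R, Rabs_pos_eq by lra.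
    pose proof (norm_plus_le (minus q u1) u1) as T.
    apply Rle_lt_trans with (s * (1 + norm u1)).
    { apply Rmult_le_compat_l; [lra|]; eapply Rle_trans; [exact T|].
      apply Rplus_le_compat; [left; exact Nq|right; reflexivity]. }
    apply Rlt_le_trans with (s * (2 + norm u1)); [apply Rmult_lt_compat_l; lra|].
    apply Rmult_le_reg_r with (/ (2 + norm u1)); [apply Rinv_0_lt_compat; lra|].
    rewrite Rmult_assoc, Rinv_r by lra; unfold Rdiv in *; lra.
- apply continuous_ext_loc with u; [|now apply Cu].
  exists (mkposreal t Hp); intros s Hs.
  apply ball_Rabs in Hs; simpl in Hs.
  apply Rabs_lt_between in Hs; rewrite clamp_pos by lra; reflexivity.
Qed.

Section Solution.
Variable L : operator H.
Hypothesis Llin : linear_op L.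
Hypothesis Lclosed : closed_op L.

Lemma solution_cont (g u : R -> V) (u1 : V) :
  is_solution L g zero u1 u -> cont (clamp u).
Proof.
intros [[du [ddu Hu]] [_ H1]]; apply (clamp_cont u u1); [|exact H1].
intros t Ht; apply (ex_derive_continuous (V := V)).
exists (du t); apply (Hu t Ht).
Qed.

(** Twice integrated form of the equation. In contrast to the equation itself it
    involves continuous curves only, up to [t = 0]. *)
Lemma solution_mild (g u : R -> V) (u1 : V) (t : R) :
  cont g -> is_solution L g zero u1 u -> 0 <= t ->
  graph L (prim (prim (clamp u)) t)
    (minus (plus (prim (fun _ => u1) t) (prim (prim g) t)) (clamp u t)).
Proof.
intros Cg Hsol Ht.
assert (Cu := solution_cont g u u1 Hsol).
destruct Hsol as [[du [ddu Hu]] [H0 H1]].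
assert (Hu0 : clamp u 0 = zero) by (rewrite clamp_pos by lra; exact H0).
destruct (Rle_lt_or_eq_dec 0 t Ht) as [Hpos| <-].
2:{ rewrite !prim_0, Hu0.
  assert (E : minus (plus (zero : V) zero) zero = zero) by vec.
  exact (eq_ind_r (graph L zero) (graph_zero L Llin) E). }
set (X := prim (prim (clamp u))).
set (Y := fun s => minus (prim (prim g) s) (clamp u s)).
assert (HG : graph L (minus (minus (X t) (X 0)) (scal t zero))
                     (minus (minus (Y t) (Y 0)) (scal t (minus zero u1)))).
{ apply (graph_second_increment L Llin Lclosed X Y (prim (clamp u))
    (fun s => minus (prim g s) (du s)) (clamp u) (fun s => minus (g s) (ddu s))); auto.
  - intros s Hs; destruct (Hu s Hs) as [D1 [D2 [Dm E]]].
    split; [apply prim_derive, prim_cont, Cu|].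
    split; [apply prim_derive, Cu|].
    split; [|split; [|split]].
    + apply (is_derive_minus (V := V)); [apply prim_derive, prim_cont, Cg|].
      apply (is_derive_ext_loc (V := V) u); [|exact D1].
      exists (mkposreal s Hs); intros r Hr.
      apply ball_Rabs in Hr; simpl in Hr.
      apply Rabs_lt_between in Hr; rewrite clamp_pos by lra; reflexivity.
    + apply (is_derive_minus (V := V)); [apply prim_derive, Cg|exact D2].
    + rewrite clamp_pos by lra; exact Dm.
    + rewrite clamp_pos by lra; rewrite <- E.
      change (L (u s) = minus (plus (ddu s) (L (u s) : V)) (ddu s)); vec.
  - exact (right_quotient_prim (clamp u) Cu).
  - apply filterlim_ext_loc with
      (fun e => minus (scal (/ e) (minus (prim (prim g) e) (prim (prim g) 0)))
                      (scal (/ e) (minus (u e) (u 0)))).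
    + exists (mkposreal 1 Rlt_0_1); intros e _ He.
      unfold Y; rewrite !clamp_pos by lra; vec.
    + apply (lim_minus (at_right 0)); [|exact H1].
      exact (right_quotient_prim g Cg). }
assert (Et : prim (fun _ => u1) t = cmul (RtoC t) u1).
{ unfold prim; rewrite (RInt_const (V := V)), Rminus_0_r; reflexivity. }
assert (EX : X t = minus (minus (X t) (X 0)) (scal t zero))
  by (unfold X; rewrite (prim_0 (prim (clamp u))); vec).
assert (EY : minus (plus (prim (fun _ => u1) t) (prim (prim g) t)) (clamp u t) =
  minus (minus (Y t) (Y 0)) (scal t (minus zero u1)))
  by (unfold Y; rewrite Hu0, (prim_0 (prim g)), Et; vec).
rewrite EX, EY; exact HG.
Qed.

Lemma solution_laplace (g u : R -> V) (u1 Gam : V) (beta : R) (p : C) :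
  cont g -> is_solution L g zero u1 u ->
  0 < beta < Re p -> growth beta g -> growth beta (prim (clamp u)) -> is_lap g p Gam ->
  exists X, is_lap (clamp u) p X /\ graph L X (minus (plus u1 Gam) (cmul (p * p) X)).
Proof.
intros Cg Hsol Hb Gg Gu HGam.
assert (Cu := solution_cont g u u1 Hsol).
assert (Hp0 : p <> RtoC 0) by (intros ->; simpl in Hb; lra).
destruct (is_lap_ex beta (prim (prim (clamp u))) p) as [Z HZ];
  [auto using prim_cont|apply growth_prim; auto using prim_cont; lra|lra|].
assert (HY : is_lap (prim (clamp u)) p (cmul p Z)).
{ apply (is_lap_of_prim beta); auto using prim_cont; [|lra].
  apply growth_prim; auto using prim_cont; lra. }
assert (HX : is_lap (clamp u) p (cmul p (cmul p Z))).
{ apply (is_lap_of_prim beta); auto; lra. }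
exists (cmul p (cmul p Z)); split; auto.
assert (HF : is_lap (fun t => minus (plus (prim (fun _ => u1) t) (prim (prim g) t)) (clamp u t)) p
  (minus (plus (cmul (/ p) (cmul (/ p) u1)) (cmul (/ p) (cmul (/ p) Gam))) (cmul p (cmul p Z)))).
{ apply is_lap_minus; auto using cont_plus, prim_cont, cont_const.
  apply is_lap_plus; auto using prim_cont, cont_const.
  - apply (is_lap_prim beta); auto using cont_const; try lra.
    + apply growth_prim; auto using cont_const; [lra|apply growth_const; lra].
    + apply is_lap_const; lra.
  - apply (is_lap_prim beta); auto using prim_cont; try lra.
    + apply growth_prim; auto using prim_cont; [lra|apply growth_prim; auto; lra].
    + apply (is_lap_prim beta); auto; try lra; apply growth_prim; auto; lra. }
assert (G := graph_lap L Llin Lclosed _ _ p _ _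
  (prim_cont _ (prim_cont _ Cu))
  (cont_minus _ _ (cont_plus _ _ (prim_cont _ (cont_const u1)) (prim_cont _ (prim_cont _ Cg))) Cu)
  (fun t Ht => solution_mild g u u1 t Cg Hsol Ht) HZ HF).
apply (graph_cmul L Llin (p * p)) in G.
replace (cmul p (cmul p Z)) with (cmul (p * p) Z) at 1 by vec.
replace (minus (plus u1 Gam) (cmul (p * p) (cmul p (cmul p Z)))) with
  (cmul (p * p) (minus (plus (cmul (/ p) (cmul (/ p) u1)) (cmul (/ p) (cmul (/ p) Gam))) (cmul p (cmul p Z)))); auto.
vec; field; auto.
Qed.

Lemma is_inverse_unique (p : C) (f x y : V) :
  is_inverse_at L p f x -> graph L y (minus f (cmul (p * p) y)) -> y = x.
Proof.
intros [Inj [Dx Ex]] Gy.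
assert (Gx : graph L x (minus f (cmul (p * p) x))).
{ split; [exact Dx|].
  change (shift L p x) with (plus (L x : V) (cmul (p * p) x)) in Ex; rewrite <- Ex.
  change ((L x : V) = minus (plus (L x : V) (cmul (p * p) x)) (cmul (p * p) x)); vec. }
pose proof (graph_plus L Llin _ _ _ _ Gy (graph_cmul L Llin (- (1)) _ _ Gx)) as [D E].
assert (Z : plus y (cmul (- (1)) x) = zero).
{ apply Inj; [exact D|].
  change (plus (L (plus y (cmul (- (1)) x)) : V) (cmul (p * p) (plus y (cmul (- (1)) x))) = zero).
  eapply eq_trans; [apply (f_equal (fun z : V => plus z _)); exact E|]; vec. }
replace y with (plus (plus y (cmul (- (1)) x)) x) by vec.
eapply eq_trans; [apply (f_equal (fun z : V => plus z x)); exact Z|]; vec.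
Qed.

End Solution.

(** * The limiting amplitude *)

Lemma locally_Cmod (q0 : C) (P : C -> Prop) :
  locally q0 P <-> exists delta, 0 < delta /\ forall q, Cmod (q - q0) < delta -> P q.
Proof.
rewrite (locally_C q0 P); split.
- intros [d Hd]; exists d; split; [apply cond_pos|]; intros q Hq; apply Hd; exact Hq.
- intros [d [Hd HP]]; exists (mkposreal d Hd); intros q Hq; apply HP; exact Hq.
Qed.

Lemma lim_Cinv (a q0 : C) :
  q0 <> a -> filterlim (fun q : C => / (q - a))%C (locally q0) (locally (/ (q0 - a)))%C.
Proof.
intros Hne P HP; apply locally_Cmod in HP; destruct HP as [e [He HP]].
assert (Hd : (q0 - a)%C <> RtoC 0).
{ intros E; apply Hne; replace q0 with ((q0 - a) + a)%C by ring; rewrite E; ring. }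
set (m := Cmod (q0 - a)).
assert (Hm : 0 < m) by now apply Cmod_gt_0.
assert (Hm2 : 0 < e * (m / 2 * m)) by (repeat apply Rmult_lt_0_compat; lra).
apply locally_Cmod; exists (Rmin (m / 2) (e * (m / 2 * m))); split; [apply Rmin_glb_lt; lra|].
intros q Hq; apply HP.
pose proof (Rmin_l (m / 2) (e * (m / 2 * m))); pose proof (Rmin_r (m / 2) (e * (m / 2 * m))).
assert (Hlow : m / 2 <= Cmod (q - a)).
{ pose proof (Cmod_triangle (q - a) (q0 - q)) as T.
  replace (q - a + (q0 - q))%C with (q0 - a)%C in T by ring; fold m in T.
  replace (q0 - q)%C with (- (q - q0))%C in T by ring; rewrite Cmod_opp in T; lra. }
assert (Hq0 : (q - a)%C <> RtoC 0) by (intros E; rewrite E, Cmod_0 in Hlow; lra).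
replace (/ (q - a) - / (q0 - a))%C with ((q0 - q) * / ((q - a) * (q0 - a)))%C by (field; auto).
rewrite Cmod_mult, Cmod_inv, Cmod_mult by (apply Cmult_neq_0; auto); fold m.
replace (q0 - q)%C with (- (q - q0))%C by ring; rewrite Cmod_opp.
apply Rmult_lt_reg_r with (Cmod (q - a) * m); [apply Rmult_lt_0_compat; lra|].
rewrite Rmult_assoc, Rinv_l, Rmult_1_r by (apply Rgt_not_eq, Rmult_lt_0_compat; lra).
eapply Rlt_le_trans; [exact Hq|]; eapply Rle_trans; [eassumption|].
apply Rmult_le_compat_l; [lra|]; apply Rmult_le_compat_r; lra.
Qed.

Definition pole_sum (n : nat) (a : nat -> C) (v : nat -> V) (q : C) : V :=
  sum_n_m (fun j => cmul (/ (q - a j)) (v j)) 1 n.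

Lemma pole_sum_0 (a : nat -> C) (v : nat -> V) (q : C) : pole_sum 0 a v q = zero.
Proof. apply (sum_n_m_zero (G := V)); lia. Qed.

Lemma pole_sum_S (n : nat) (a : nat -> C) (v : nat -> V) (q : C) :
  pole_sum (S n) a v q = plus (pole_sum n a v q) (cmul (/ (q - a (S n))) (v (S n))).
Proof. apply (sum_n_Sm (G := V)); lia. Qed.

Lemma pole_sum_lim (n : nat) (a : nat -> C) (v : nat -> V) (q0 : C) :
  (forall j, (1 <= j <= n)%nat -> q0 <> a j) ->
  filterlim (pole_sum n a v) (locally q0) (locally (pole_sum n a v q0)).
Proof.
induction n as [|n IH]; intros Ha.
- apply filterlim_ext with (fun _ => pole_sum 0 a v q0); [|apply filterlim_const].
  intros q; rewrite !pole_sum_0; reflexivity.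
- apply filterlim_ext with (fun q => plus (pole_sum n a v q) (cmul (/ (q - a (S n))) (v (S n)))).
  { intros q; now rewrite pole_sum_S. }
  rewrite pole_sum_S; apply (lim_plus (locally q0)).
  + apply IH; intros j Hj; apply Ha; lia.
  + apply (lim_cmul (locally q0)); [|apply filterlim_const].
    apply lim_Cinv, Ha; lia.
Qed.

(** The poles in the open right half-plane keep a distance from the imaginary
    axis, so that in a thin strip they contribute a bounded term. *)
Lemma pole_sum_strip (n : nat) (a : nat -> C) (v : nat -> V) :
  (forall m, (1 <= m <= n)%nat -> 0 < Re (a m)) ->
  exists s0 B, 0 < s0 /\ 0 <= B /\ forall q, Re q < s0 ->
    (forall m, (1 <= m <= n)%nat -> q <> a m) /\ norm (pole_sum n a v q) <= B.
Proof.
induction n as [|n IH]; intros Ha.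
- exists 1, 0; split; [lra|split; [lra|]]; intros q _; split; [intros; lia|].
  right; rewrite pole_sum_0; apply norm_0.
- destruct IH as [s0 [B [Hs [HB Hq]]]]; [intros m Hm; apply Ha; lia|].
  assert (Hr : 0 < Re (a (S n))) by (apply Ha; lia).
  set (r := Re (a (S n))) in *.
  exists (Rmin s0 (r / 2)), (B + / (r / 2) * norm (v (S n))).
  pose proof (norm_ge_0 (V := V) (v (S n))) as Pv.
  assert (Hi : 0 < / (r / 2)) by (apply Rinv_0_lt_compat; lra).
  split; [apply Rmin_glb_lt; lra|split].
  { apply Rplus_le_le_0_compat; auto; apply Rmult_le_pos; [lra|exact Pv]. }
  intros q Hlt.
  pose proof (Rmin_l s0 (r / 2)); pose proof (Rmin_r s0 (r / 2)).
  destruct (Hq q ltac:(lra)) as [Hne HN].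
  assert (Hd : r / 2 <= Cmod (q - a (S n))).
  { eapply Rle_trans; [|apply re_le_Cmod].
    replace (Re (q - a (S n))) with (Re q - r) by (unfold r; destruct q, (a (S n)); simpl; ring).
    rewrite Rabs_left1; lra. }
  assert (Hq0 : (q - a (S n))%C <> RtoC 0) by (intros E; rewrite E, Cmod_0 in Hd; lra).
  split.
  + intros m Hm E; destruct (Nat.eq_dec m (S n)) as [->|Hmn].
    * apply Hq0; rewrite E; ring.
    * apply (Hne m); auto; lia.
  + rewrite pole_sum_S; eapply Rle_trans; [apply norm_plus_le|].
    apply Rplus_le_compat; auto.
    rewrite norm_cmul, Cmod_inv by auto; apply Rmult_le_compat_r; [exact Pv|].
    apply Rinv_le_contravar; lra.
Qed.

Lemma Re_bounded (n : nat) (a : nat -> C) :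
  exists s, forall m, (1 <= m <= n)%nat -> Re (a m) <= s.
Proof.
induction n as [|n [s Hs]]; [exists 0; intros; lia|].
exists (Rmax s (Re (a (S n)))); intros m Hm.
destruct (Nat.eq_dec m (S n)) as [->|Hne]; [apply Rmax_r|].
eapply Rle_trans; [apply Hs; lia|apply Rmax_l].
Qed.

Lemma cesaro_plus (x y : R -> V) (u v : V) :
  cont x -> cont y -> cesaro_lim x u -> cesaro_lim y v ->
  cesaro_lim (fun t => plus (x t) (y t)) (plus u v).
Proof.
intros Cx Cy Hx Hy.
eapply filterlim_ext; [|exact (lim_plus _ _ _ _ _ Hx Hy)].
intros t; simpl.
rewrite (prim_ext_all (prim (fun t => plus (x t) (y t))) (fun t => plus (prim x t) (prim y t)))
  by (intros s; now rewrite prim_plus).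
rewrite prim_plus by auto using prim_cont; vec.
Qed.

Lemma cesaro_cexp (mu : C) (v : V) :
  Re mu = 0 -> mu <> RtoC 0 ->
  cesaro_lim (fun t => cmul (cexp mu t) v) (cmul (/ (0 - mu)) v).
Proof.
intros Hre Hmu.
assert (P1 : forall t, prim (fun t => cmul (cexp mu t) v) t = cmul (/ mu) (minus (cmul (cexp mu t) v) v)).
{ intros t; rewrite (prim_unique _ (fun t => cmul (/ mu) (cmul (cexp mu t) v))).
  - rewrite cexp_0_r; vec.
  - apply cont_cexp_cmul, cont_const.
  - intros s; evar_last.
    + apply is_derive_cmul, is_derive_cexp_cmul, (is_derive_const (V := V)).
    + vec; field; auto. }
assert (P2 : forall t, prim (prim (fun t => cmul (cexp mu t) v)) t =
  minus (cmul (/ mu) (prim (fun t => cmul (cexp mu t) v) t)) (cmul (RtoC t) (cmul (/ mu) v))).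
{ intros t.
  assert (Ce : cont (fun t => cmul (cexp mu t) v)) by apply cont_cexp_cmul, cont_const.
  rewrite (prim_unique _ (fun t => minus (cmul (/ mu) (prim (fun t => cmul (cexp mu t) v) t))
    (scal t (cmul (/ mu) v)))).
  - rewrite prim_0; vec.
  - apply prim_cont, Ce.
  - intros s; evar_last.
    + apply (is_derive_minus (V := V)).
      * apply is_derive_cmul, (prim_derive _ s Ce).
      * apply (is_derive_scal_l (V := V) (fun t => t)), (is_derive_id (K := R_AbsRing)).
    + cbv beta; rewrite P1; unfold one; simpl; vec. }
apply filterlim_norm; [apply filter_filter|]; intros eps He.
set (K := Cmod (/ mu) * (Cmod (/ mu) * (norm v + norm v))).
assert (HK : 0 <= K).
{ pose proof (norm_ge_0 (V := V) v); repeat apply Rmult_le_pos; try apply Cmod_ge_0; lra. }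
exists (1 + K / eps); intros t Ht.
assert (0 <= K / eps) by (apply Rdiv_le_0_compat; lra).
assert (E : minus (scal (/ t) (prim (prim (fun t => cmul (cexp mu t) v)) t)) (cmul (/ (0 - mu)) v) =
  cmul (RtoC (/ t)) (cmul (/ mu) (cmul (/ mu) (minus (cmul (cexp mu t) v) v)))).
{ assert (Hinv : (/ (0 - mu) = - / mu)%C).
  { replace (0 - mu)%C with (- (1) * mu)%C by ring.
    field; auto. }
  assert (Ht0 : RtoC t <> RtoC 0) by (intros E; apply RtoC_inj in E; lra).
  rewrite Hinv, P2, P1; vec; rewrite RtoC_inv by lra; field; auto. }
eapply Rle_lt_trans; [right; exact (f_equal norm E)|].
rewrite !norm_cmul, Cmod_R, Rabs_pos_eq by (left; apply Rinv_0_lt_compat; lra).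
assert (T : norm (minus (cmul (cexp mu t) v) v) <= norm v + norm v).
{ eapply Rle_trans; [apply norm_minus_le|].
  rewrite norm_cmul, Cmod_cexp, Hre, Rmult_0_l, exp_0, Rmult_1_l; lra. }
apply Rle_lt_trans with (/ t * K).
- apply Rmult_le_compat_l; [left; apply Rinv_0_lt_compat; lra|].
  unfold K; repeat (apply Rmult_le_compat_l; [apply Cmod_ge_0|]); exact T.
- apply Rmult_lt_reg_l with t; [lra|].
  rewrite <- Rmult_assoc, Rinv_r, Rmult_1_l by lra.
  replace K with (K / eps * eps) by (field; lra); apply Rmult_lt_compat_r; lra.
Qed.

(** The almost periodic part of the solution: a trigonometric sum accounts for the
    simple poles on the imaginary axis, and its mean is found by integration. *)
Lemma trig_sum (n : nat) (mu : nat -> C) (v : nat -> V) :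
  (forall j, (1 <= j <= n)%nat -> Re (mu j) = 0 /\ mu j <> RtoC 0) ->
  exists x, cont x /\ (forall eps, 0 < eps -> growth eps (prim x)) /\
    (forall p, 0 < Re p -> is_lap x p (pole_sum n mu v p)) /\
    cesaro_lim x (pole_sum n mu v 0).
Proof.
induction n as [|n IH]; intros Hmu.
- exists (fun _ => zero).
  assert (P0 : forall t, prim (fun _ => zero) t = zero).
  { intros t; unfold prim; rewrite (RInt_const (V := V)); apply (scal_zero_r (V := V)). }
  split; [apply cont_const|split; [|split]].
  + intros eps He; apply growth_prim; auto using cont_const; apply growth_const; lra.
  + intros p Hp; rewrite pole_sum_0.
    exact (eq_ind _ (is_lap _ p) (is_lap_const zero p Hp) _ (cmul_0_r (/ p))).
  + rewrite pole_sum_0.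
    eapply filterlim_ext; [|apply filterlim_const].
    intros t; simpl; rewrite (prim_ext_all _ (fun _ => zero)) by apply P0.
    rewrite P0; vec.
- destruct IH as [x [Cx [Gx [Lx Sx]]]]; [intros j Hj; apply Hmu; lia|].
  destruct (Hmu (S n) ltac:(lia)) as [Hre Hne].
  assert (Ce : cont (fun t => cmul (cexp (mu (S n)) t) (v (S n)))) by apply cont_cexp_cmul, cont_const.
  exists (fun t => plus (x t) (cmul (cexp (mu (S n)) t) (v (S n)))).
  split; [now apply cont_plus|split; [|split]].
  + intros eps He.
    apply growth_ext with (fun t => plus (prim x t) (prim (fun t => cmul (cexp (mu (S n)) t) (v (S n))) t)).
    { intros t _; now rewrite prim_plus. }
    apply growth_plus; auto; apply growth_prim; auto.
    apply growth_weaken with (Re (mu (S n))); [lra|apply growth_cexp_const].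
  + intros p Hp; rewrite pole_sum_S; apply is_lap_plus; auto.
    replace p with (p - mu (S n) + mu (S n))%C at 1 by ring.
    apply is_lap_shift, is_lap_const.
    replace (Re (p - mu (S n))) with (Re p - Re (mu (S n)))
      by (destruct p, (mu (S n)); simpl; ring); lra.
  + rewrite pole_sum_S; apply cesaro_plus; auto; now apply cesaro_cexp.
Qed.

Lemma growth_of_eventual (a eps C0 T : R) (x : R -> V) :
  0 <= a -> 0 < eps -> growth a x ->
  (forall t, T <= t -> norm (x t) <= C0 * exp (eps * t)) -> growth eps x.
Proof.
intros Ha He [c [Hc Hx]] HT.
exists (Rabs C0 + c * exp (a * Rabs T)).
assert (P : 0 <= c * exp (a * Rabs T)) by (apply Rmult_le_pos; auto; left; apply exp_pos).
split; [pose proof (Rabs_pos C0); lra|]; intros t Ht.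
pose proof (exp_ineq1_le (eps * t)) as E; assert (0 <= eps * t) by nra.
destruct (Rle_lt_dec T t) as [Hle|Hlt].
- eapply Rle_trans; [apply HT, Hle|]; apply Rmult_le_compat_r; [lra|].
  pose proof (Rle_abs C0); lra.
- eapply Rle_trans; [apply Hx, Ht|].
  assert (exp (a * t) <= exp (a * Rabs T)).
  { apply Rnot_lt_le; intros Hexp; apply exp_lt_inv in Hexp.
    pose proof (Rle_abs T); nra. }
  apply Rle_trans with (c * exp (a * Rabs T) * 1).
  + rewrite Rmult_1_r; now apply Rmult_le_compat_l.
  + apply Rmult_le_compat; try lra; pose proof (Rabs_pos C0); lra.
Qed.

Lemma prim_clamp (u : R -> V) (t : R) : 0 <= t -> prim (clamp u) t = integral u 0 t.
Proof. intros Ht; apply prim_ext; auto; intros s Hs; apply clamp_pos; lra. Qed.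

Lemma exp_bounded_growth (u : R -> V) :
  exp_bounded u -> exists a, 0 < a /\ growth a (clamp u).
Proof.
intros [c [a [Hc [Ha Hu]]]]; exists (a + 1); split; [lra|].
apply growth_weaken with a; [lra|]; exists c; split; [lra|]; intros t Ht.
rewrite clamp_pos by exact Ht; exact (Hu t Ht).
Qed.

Section Amplitude.
Variables (L : operator H) (f : H).
Hypothesis Llin : linear_op L.
Hypothesis Lclosed : closed_op L.
Variable w : R -> H.
Hypothesis wsol : is_solution L (fun _ => zero) zero f w.
Hypothesis wexp : exp_bounded w.

Let wc : R -> V := clamp w.

Lemma impulse_growth :
  (forall eps, 0 < eps ->
     exists C0 T, forall t, T <= t -> norm (integral w 0 t) <= C0 * exp (eps * t)) ->
  forall eps, 0 < eps -> growth eps (prim wc).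
Proof.
intros wint eps He.
destruct (exp_bounded_growth w wexp) as [a [Ha Ga]].
destruct (wint eps He) as [C0 [T HT]].
apply (growth_of_eventual a eps C0 (Rmax 0 T)); auto; [lra| |].
- apply growth_prim; auto; exact (solution_cont L _ w f wsol).
- intros t Ht; pose proof (Rmax_l 0 T); pose proof (Rmax_r 0 T).
  unfold wc; rewrite prim_clamp by lra; apply HT; lra.
Qed.

(** Because the primitive of [w] grows slower than any exponential, the resolvent
    applied to [f] is the transform of [w] all the way to the imaginary axis, and
    not only to the right of the growth rate of [w] itself. *)
Lemma impulse_laplace (p : C) (x : V) :
  (forall eps, 0 < eps -> growth eps (prim wc)) ->
  0 < Re p -> is_inverse_at L p f x -> is_lap wc p x.
Proof.
intros Gw Hp Hx.
assert (Lz : is_lap (fun _ => zero) p zero)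
  by exact (eq_ind _ (is_lap _ p) (is_lap_const zero p Hp) _ (cmul_0_r (/ p))).
destruct (solution_laplace L Llin Lclosed (fun _ => zero) w f zero (Re p / 2) p)
  as [X [HX GX]]; auto using cont_const; try lra.
- apply growth_const; lra.
- apply Gw; lra.
- rewrite <- (is_inverse_unique L Llin p f x X Hx); [exact HX|].
  assert (E : minus (plus (f : V) zero) (cmul (p * p) X) = minus (f : V) (cmul (p * p) X)) by vec.
  exact (eq_ind _ (graph L X) GX _ E).
Qed.

(** Both sides have the transform [W p / (p + i k)] far to the right, the left one
    by the equation and the right one because it is a convolution; it is turned
    into a primitive by modulation. *)
Lemma duhamel (k : R) (W : C -> V) (s1 t : R) (u : R -> H) :
  (forall p, s1 < Re p -> is_inverse_at L p f (W p)) ->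
  (forall p, s1 < Re p -> is_lap wc p (W p)) ->
  is_solution L (fun t => scal (cis (- (k * t))) f) zero zero u -> exp_bounded u ->
  0 < t -> clamp u t = cmul (cexp (- (Ci * RtoC k)) t) (prim (fun s => cmul (cexp (Ci * RtoC k) s) (wc s)) t).
Proof.
intros HW Lw usol uexp Ht.
set (q0 := (- (Ci * RtoC k))%C).
set (om := fun s => cmul (cexp (Ci * RtoC k) s) (wc s)).
assert (Rq : Re q0 = 0) by (unfold q0; simpl; ring).
assert (Rk : Re (Ci * RtoC k) = 0) by (simpl; ring).
assert (Cw : cont wc) by exact (solution_cont L _ w f wsol).
assert (Co : cont om) by now apply cont_cexp_cmul.
assert (usol' : is_solution L (fun t => cmul (cexp q0 t) f) zero zero u).
{ destruct usol as [[du [ddu Hu]] Hi]; split; [|exact Hi].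
  exists du, ddu; intros s Hs; destruct (Hu s Hs) as [D1 [D2 [D3 D4]]].
  split; [exact D1|split; [exact D2|split; [exact D3|]]].
  rewrite D4; unfold q0.
  replace (- (Ci * RtoC k))%C with (Ci * RtoC (- k))%C by (rewrite RtoC_opp; ring).
  rewrite cexp_imaginary, Ropp_mult_distr_l; reflexivity. }
assert (Cu : cont (clamp u)) by exact (solution_cont L _ u zero usol').
destruct (exp_bounded_growth u uexp) as [au [Hau Gu]].
destruct (exp_bounded_growth w wexp) as [aw [Haw Gw]].
set (beta := au + aw).
set (sigma := beta + Rabs s1 + 1).
assert (Hs1 : s1 < sigma) by (pose proof (Rle_abs s1); unfold sigma, beta; lra).
assert (Hsb : beta < sigma) by (pose proof (Rabs_pos s1); unfold sigma; lra).
assert (Hb : 0 < beta) by (unfold beta; lra).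
apply growth_weaken with (beta' := beta) in Gu; [|unfold beta; lra].
apply growth_weaken with (beta' := beta) in Gw; [|unfold beta; lra].
assert (Go : growth beta (prim om)).
{ apply growth_prim; auto.
  replace beta with (Re (Ci * RtoC k) + beta) by (rewrite Rk; ring).
  now apply growth_cexp_cmul. }
set (d := fun s => minus (clamp u s) (cmul (cexp q0 s) (prim om s))).
assert (Z : d t = zero).
{ apply (is_lap_zero d beta sigma); auto.
  - apply cont_minus; auto; apply cont_cexp_cmul, prim_cont, Co.
  - apply growth_ext with (fun s => plus (clamp u s) (cmul (- (1)) (cmul (cexp q0 s) (prim om s)))).
    { intros s _; unfold d; vec. }
    apply growth_plus; auto; apply growth_cmul.
    replace beta with (Re q0 + beta) by (rewrite Rq; ring); now apply growth_cexp_cmul.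
  - intros y; set (p := (RtoC sigma + Ci * RtoC y)%C).
    assert (Rp : Re p = sigma) by (unfold p; simpl; ring).
    assert (Rpq : Re (p - q0) = sigma) by (change (Re p + - Re q0 = sigma); lra).
    assert (Hpq : (p - q0)%C <> RtoC 0) by (intros E; rewrite E in Rpq; simpl in Rpq; lra).
    destruct (solution_laplace L Llin Lclosed (fun t => cmul (cexp q0 t) f) u zero
      (cmul (/ (p - q0)) f) beta p) as [X [HX GX]]; auto; try lra.
    + apply cont_cexp_cmul, cont_const.
    + apply growth_weaken with (Re q0); [lra|apply growth_cexp_const].
    + apply growth_prim; auto.
    + replace p with (p - q0 + q0)%C at 1 by ring.
      apply is_lap_shift, is_lap_const; lra.
    + assert (EX : cmul (p - q0) X = W p).
      { apply (is_inverse_unique L Llin p f); [apply HW; lra|].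
        apply (graph_cmul L Llin (p - q0)) in GX.
        assert (E : cmul (p - q0) (minus (plus zero (cmul (/ (p - q0)) (f : V))) (cmul (p * p) X)) =
          minus (f : V) (cmul (p * p) (cmul (p - q0) X))) by (vec; field; auto).
        exact (eq_ind _ (graph L (cmul (p - q0) X)) GX _ E). }
      assert (Hom : is_lap om (p - q0) (W p)).
      { replace (p - q0)%C with (p + Ci * RtoC k)%C by (unfold q0; ring).
        apply is_lap_shift, Lw; lra. }
      assert (Hd : is_lap d p (minus X (cmul (/ (p - q0)) (W p)))).
      { apply is_lap_minus; auto.
        - apply cont_cexp_cmul, prim_cont, Co.
        - replace p with (p - q0 + q0)%C at 1 by ring.
          apply is_lap_shift, (is_lap_prim beta); auto; lra. }
      assert (E : minus X (cmul (/ (p - q0)) (W p)) = zero) by (rewrite <- EX; vec; field; auto).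
      exact (eq_ind _ (is_lap d p) Hd _ E). }
replace (clamp u t) with (plus (d t) (cmul (cexp q0 t) (prim om t))) by (unfold d; vec).
eapply eq_trans; [apply (f_equal (fun z : V => plus z _)); exact Z|]; vec.
Qed.

Theorem limiting_amplitude
  (J : nat) (kj : nat -> R) (vj : nat -> H)
  (M : nat) (kappa : nat -> C) (b : nat -> H) (W W1 : C -> H)
  (HA : assumption_A L f J kj vj M kappa b W W1)
  (wint : forall eps : R, 0 < eps ->
     exists C0 T : R, forall t : R, T <= t -> norm (integral w 0 t) <= C0 * exp (eps * t))
  (k : R) (Hk : forall j : nat, (1 <= j <= J)%nat -> k <> kj j)
  (u : R -> H)
  (usol : is_solution L (fun t => scal (cis (- (k * t))) f) zero zero u)
  (uexp : exp_bounded u) :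
  exists v : H,
    filterlim
      (fun t : R => scal (RtoC (/ t)) (integral (fun s => scal (cis (k * s)) (u s)) 0 t))
      (Rbar_locally p_infty) (locally v) /\
    dom L v /\ minus (L v) (scal (RtoC (k * k)) v) = f.
Proof.
destruct HA as [Hkap [HW [_ [Hcont [c [gam [Hc [_ HW1]]]]]]]].
set (q0 := (- (Ci * RtoC k))%C).
assert (Rq : Re q0 = 0) by (unfold q0; simpl; ring).
set (a := fun j => (- (Ci * RtoC (kj j)))%C).
set (mu := fun j => (Ci * RtoC (k - kj j))%C).
set (S := pole_sum M kappa b).
assert (Gw := impulse_growth wint).
assert (Dec : forall p, 0 < Re p -> (forall m, (1 <= m <= M)%nat -> p <> kappa m) ->
  W p = plus (plus (pole_sum J a vj p) (W1 p)) (S p)).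
{ intros p Hp Hm; destruct (HW p Hp Hm) as [_ E].
  eapply eq_trans; [exact E|].
  apply (f_equal (fun z : V => plus (plus z (W1 p)) (S p))).
  apply (sum_n_m_ext (G := V)); intros j; unfold a, cmul; do 2 f_equal; ring. }
assert (Lw : forall p, 0 < Re p -> (forall m, (1 <= m <= M)%nat -> p <> kappa m) -> is_lap wc p (W p)).
{ intros p Hp Hm; apply impulse_laplace; auto; apply HW; auto. }
destruct (pole_sum_strip M kappa b Hkap) as [s0 [B [Hs0 [HB Strip]]]].
assert (Ha : forall j, (1 <= j <= J)%nat -> q0 <> a j).
{ intros j Hj E; apply (Hk j Hj); unfold q0, a in E; apply (f_equal Im) in E; simpl in E; lra. }
assert (Sq : forall m, (1 <= m <= M)%nat -> q0 <> kappa m) by (apply Strip; lra).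
set (v := plus (plus (pole_sum J a vj q0) (W1 q0 : V)) (S q0)).
exists v; split.
- set (om := fun s => cmul (cexp (Ci * RtoC k) s) (wc s)).
  assert (Cw : cont wc) by exact (solution_cont L _ w f wsol).
  assert (Co : cont om) by now apply cont_cexp_cmul.
  assert (Rk : Re (Ci * RtoC k) = 0) by (simpl; ring).
  (* the modulation by [exp (i k s)] moves the point [q0] to the origin *)
  assert (Shift : forall p, pole_sum J a vj (p + q0) = pole_sum J mu vj p).
  { intros p; apply (sum_n_m_ext (G := V)); intros j; do 2 f_equal.
    unfold q0, a, mu; rewrite RtoC_minus; ring. }
  assert (HT : cesaro_lim om v).
  { destruct (trig_sum J mu vj) as [x [Cx [Gx [Lx Sx]]]].
    { intros j Hj; split; [unfold mu; simpl; ring|].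
      intros E; apply (f_equal Im) in E; unfold mu in E; simpl in E; apply (Hk j Hj); lra. }
    set (Phi := fun p => plus (W1 (p + q0)%C : V) (S (p + q0)%C)).
    set (Phi0 := plus (W1 q0 : V) (S q0)).
    set (h := fun s => minus (om s) (x s)).
    assert (Ch : cont h) by now apply cont_minus.
    assert (Rpq : forall p, Re (p + q0) = Re p) by (intros p; change (Re p + Re q0 = Re p); lra).
    assert (Hh : cesaro_lim h Phi0).
    { apply (cesaro_of_laplace h Phi Phi0 s0 (c + B)); auto; [|lra| | |].
      - intros eps He.
        apply growth_ext with (fun s => plus (prim om s) (cmul (- (1)) (prim x s))).
        { intros s _.
          rewrite (prim_ext_all h (fun s => plus (om s) (cmul (- (1)) (x s)))) by (intros r; unfold h; vec).
          rewrite (prim_plus om (fun s => cmul (- (1)) (x s))) by (try apply cont_cmul; auto).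
          rewrite (prim_cmul (- (1)) x) by exact Cx; reflexivity. }
        apply growth_plus; [|apply growth_cmul; auto].
        apply growth_prim_cexp; auto.
      - intros p Hp.
        assert (Hlt : Re (p + q0) < s0) by (rewrite Rpq; lra).
        assert (E : minus (W (p + q0)%C : V) (pole_sum J mu vj p) = Phi p).
        { rewrite (Dec (p + q0)%C); [|rewrite Rpq; lra|apply Strip, Hlt].
          rewrite Shift; unfold Phi; vec. }
        rewrite <- E; apply is_lap_minus; auto; [|apply Lx; lra].
        replace p with (p + q0 + Ci * RtoC k)%C at 1 by (unfold q0; ring).
        apply is_lap_shift, Lw; [rewrite Rpq; lra|apply Strip, Hlt].
      - intros p Hp.
        eapply Rle_trans; [apply norm_plus_le|]; apply Rplus_le_compat.
        + eapply Rle_trans; [apply (HW1 (p + q0)%C); rewrite Rpq; lra|].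
          assert (P : 0 < Rpower (Cmod (p + q0)) gam) by apply exp_pos.
          apply Rmult_le_reg_r with (1 + Rpower (Cmod (p + q0)) gam); [lra|].
          unfold Rdiv; rewrite Rmult_assoc, Rinv_l by lra; nra.
        + apply Strip; rewrite Rpq; lra.
      - intros eps He.
        assert (Hq0 : 0 <= Re q0) by lra; assert (He2 : 0 < eps / 2) by lra.
        assert (L1 := proj1 (filterlim_norm (within (fun q : C => 0 <= Re q) (locally q0)) W1 (W1 q0))
          (Hcont q0 Hq0) (eps / 2) He2).
        assert (L2 := proj1 (filterlim_norm (locally q0) S (S q0))
          (pole_sum_lim M kappa b q0 Sq) (eps / 2) He2).
        apply locally_Cmod in L1; destruct L1 as [d1 [Hd1 L1]].
        apply locally_Cmod in L2; destruct L2 as [d2 [Hd2 L2]].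
        exists (Rmin d1 d2); split; [now apply Rmin_glb_lt|].
        intros p Hp Hlt; pose proof (Rmin_l d1 d2); pose proof (Rmin_r d1 d2).
        assert (Ep : (p + q0 - q0)%C = p) by ring.
        specialize (L1 (p + q0)%C); specialize (L2 (p + q0)%C).
        rewrite Ep in L1, L2.
        specialize (L1 ltac:(lra) ltac:(rewrite Rpq; lra)); specialize (L2 ltac:(lra)).
        replace (minus (Phi p) Phi0) with
          (plus (minus (W1 (p + q0)%C : V) (W1 q0)) (minus (S (p + q0)%C) (S q0)))
          by (unfold Phi, Phi0; vec).
        eapply Rle_trans; [apply norm_plus_le|].
        replace eps with (eps / 2 + eps / 2) by field.
        apply Rplus_le_compat; left; [exact L1|exact L2]. }
    assert (Hsum := cesaro_plus h x _ _ Ch Cx Hh Sx).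
    assert (E : plus Phi0 (pole_sum J mu vj 0) = v).
    { rewrite <- Shift, Cplus_0_l; unfold Phi0, v; vec. }
    rewrite <- E.
    eapply filterlim_ext; [|exact Hsum].
    intros t; simpl; apply (f_equal (fun z : V => scal (/ t) z)).
    assert (Eom : forall s, plus (h s) (x s) = om s) by (intros s; unfold h; vec).
    apply prim_ext_all; intros s; apply prim_ext_all; exact Eom. }
  apply filterlim_ext_loc with (2 := HT).
  exists 0; intros t Ht; simpl.
  apply (f_equal (fun z : V => scal (/ t) z)).
  apply prim_ext; [lra|]; intros s Hs.
  destruct (Re_bounded M kappa) as [sK HsK].
  assert (Hfar : forall p, Rmax 0 sK < Re p ->
    0 < Re p /\ forall m, (1 <= m <= M)%nat -> p <> kappa m).
  { intros p Hp; pose proof (Rmax_l 0 sK); pose proof (Rmax_r 0 sK); split; [lra|].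
    intros m Hm E; pose proof (HsK m Hm); subst p; lra. }
  assert (Du : clamp u s = cmul (cexp q0 s) (prim om s)).
  { apply (duhamel k W (Rmax 0 sK) s u); auto; try lra.
    - intros p Hp; apply HW; apply (Hfar p Hp).
    - intros p Hp; apply Lw; apply (Hfar p Hp). }
  rewrite clamp_pos in Du by lra.
  change (prim om s = cmul (cis (k * s)) (u s)).
  rewrite Du, <- cexp_imaginary, cmul_assoc, cexp_plus.
  unfold q0; replace (Ci * RtoC k + - (Ci * RtoC k))%C with (RtoC 0) by ring.
  now rewrite cexp_0_l, cmul_1.
- set (path := fun sigma : R => (RtoC sigma + q0)%C).
  assert (Rpath : forall s, Re (path s) = s) by (intros s; change (s + Re q0 = s); lra).
  assert (Lpath : filterlim path (at_right 0) (locally q0)).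
  { intros P HP; apply locally_Cmod in HP; destruct HP as [d [Hd HP]].
    exists (mkposreal d Hd); intros s Hs Hpos; apply HP; unfold path.
    replace (RtoC s + q0 - q0)%C with (RtoC s) by ring; rewrite Cmod_R.
    apply ball_Rabs in Hs; simpl in Hs.
    rewrite Rminus_0_r in Hs; exact Hs. }
  assert (Lpathw : filterlim path (at_right 0) (within (fun q : C => 0 <= Re q) (locally q0))).
  { intros P HP; unfold within in HP; apply Lpath in HP; unfold filtermap in HP.
    destruct HP as [d HP]; exists d; intros s Hs Hpos; apply (HP s Hs Hpos); rewrite Rpath; lra. }
  assert (LW : filterlim (fun s => plus (plus (pole_sum J a vj (path s)) (W1 (path s) : V)) (S (path s)))
    (at_right 0) (locally v)).
  { apply (lim_plus (at_right 0)); [apply (lim_plus (at_right 0))|].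
    - eapply filterlim_comp; [exact Lpath|now apply pole_sum_lim].
    - eapply filterlim_comp; [exact Lpathw|apply Hcont; lra].
    - eapply filterlim_comp; [exact Lpath|now apply pole_sum_lim]. }
  assert (G : graph L v (minus (f : V) (cmul (q0 * q0) v))).
  { apply (graph_lim L Lclosed (at_right 0)
      (fun s => plus (plus (pole_sum J a vj (path s)) (W1 (path s) : V)) (S (path s)))
      (fun s => minus (f : V) (cmul (path s * path s)
         (plus (plus (pole_sum J a vj (path s)) (W1 (path s) : V)) (S (path s)))))).
    - exists (mkposreal s0 Hs0); intros s Hs Hpos.
      apply ball_Rabs in Hs; simpl in Hs.
      rewrite Rminus_0_r, Rabs_pos_eq in Hs by lra.
      assert (Hm : forall m, (1 <= m <= M)%nat -> path s <> kappa m)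
        by (apply Strip; rewrite Rpath; lra).
      assert (Hp : 0 < Re (path s)) by (rewrite Rpath; lra).
      rewrite <- (Dec _ Hp Hm).
      destruct (HW _ Hp Hm) as [[_ [D E]] _]; split; [exact D|].
      change (shift L (path s) (W (path s))) with
        (plus (L (W (path s)) : V) (cmul (path s * path s) (W (path s)))) in E.
      rewrite <- E.
      change ((L (W (path s)) : V) = minus (plus (L (W (path s)) : V) (cmul (path s * path s) (W (path s))))
        (cmul (path s * path s) (W (path s)))); vec.
    - exact LW.
    - apply (lim_minus (at_right 0)); [apply filterlim_const|].
      rewrite <- cmul_assoc.
      eapply filterlim_ext; [|exact (lim_cmul _ path _ _ _ Lpath (lim_cmul _ path _ _ _ Lpath LW))].
      intros s; apply cmul_assoc. }
  destruct G as [D E]; split; [exact D|].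
  change (minus (L v : V) (cmul (RtoC (k * k)) v) = f).
  eapply eq_trans; [apply (f_equal (fun z : V => minus z _)); exact E|].
  assert (Hq : (q0 * q0)%C = (- RtoC (k * k))%C).
  { unfold q0, Ci, RtoC, Cmult, Copp; simpl; f_equal; ring. }
  rewrite Hq; vec.
Qed.

End Amplitude.

End RealifiedSpace.

Theorem theorem1p4
  (H : CompleteNormedModule C_AbsRing) (ip : H -> H -> C)
  (Hip : is_inner_product ip)
  (L : operator H)
  (Llin : linear_op L) (Lclosed : closed_op L) (Ldense : densely_defined L)
  (f : H) (fgen : generic L f)
  (w : R -> H)
  (wsol : is_solution L (fun _ => zero) zero f w)
  (wexp : exp_bounded w)
  (J : nat) (kj : nat -> R) (vj : nat -> H)
  (M : nat) (kappa : nat -> C) (b : nat -> H) (W W1 : C -> H)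
  (HA : assumption_A L f J kj vj M kappa b W W1)
  (HB : assumption_B W1)
  (wint : forall eps : R, 0 < eps ->
     exists C0 T : R, forall t : R, T <= t ->
       norm (integral w 0 t) <= C0 * exp (eps * t)) :
  forall k : R, (forall j : nat, (1 <= j <= J)%nat -> k <> kj j) ->
  forall u : R -> H,
    is_solution L (fun t => scal (cis (- (k * t))) f) zero zero u ->
    exp_bounded u ->
    exists v : H,
      filterlim
        (fun t : R => scal (RtoC (/ t)) (integral (fun s => scal (cis (k * s)) (u s)) 0 t))
        (Rbar_locally p_infty) (locally v) /\
      dom L v /\ minus (L v) (scal (RtoC (k * k)) v) = f.

Proof.
intros k Hk u usol uexp.
exact (limiting_amplitude H L f Llin Lclosed w wsol wexp J kj vj M kappa b W W1
  HA wint k Hk u usol uexp).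
Qed.
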